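(* Let $\tilde P_1,\tilde P_2$ be non-deterministic random probability measures on $\mathbb{X}$, defined on the same probability space, with the same mean measure $P_0=\mathbb{E}[\tilde P_1]=\mathbb{E}[\tilde P_2]$, such that for some $\eta\in[-1,1]$, $\lambda_1,\lambda_2\in(0,1]$ and every measurable $A\subset\mathbb{X}$, $\mathrm{Cov}(\tilde P_1(A),\tilde P_2(A))=\eta P_0(A)(1-P_0(A))$ and $\mathrm{Var}(\tilde P_i(A))=\lambda_iP_0(A)(1-P_0(A))$ for $i=1,2$. Let $f$ be a probability density kernel on $\mathbb{Y}\times\mathbb{X}$ such that $\{f(\cdot;x)\}_{x\in\mathbb{X}}$ is identifiable. Then for every characteristic kernel $k$ on $\mathbb{Y}$ and every measurable set $A\subset\mathbb{X}$ such that $\tilde P_1(A)$ and $\tilde P_2(A)$ are not deterministic, $$\mathrm{Corr}_k(f_{\tilde P_1},f_{\tilde P_2})=\mathrm{Corr}_{k_f}(\tilde P_1,\tilde P_2)=\mathrm{Corr}\big(\tilde P_1(A),\tilde P_2(A)\big),$$ where $k_f(x_1,x_2)=\iint_{\mathbb{Y}\times\mathbb{Y}}k(y_1,y_2)f(y_1;x_1)f(y_2;x_2)\,dy_1\,dy_2$.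
   Context: $\mathbb{X}$ (latent space) and $\mathbb{Y}$ (observation space) are locally compact Polish spaces with their Borel $\sigma$-algebras; $\mathbb{Y}$ carries a reference $\sigma$-finite measure denoted $dy$. A probability density kernel $f$ on $\mathbb{Y}\times\mathbb{X}$ is a jointly measurable function $(y,x)\mapsto f(y;x)\ge0$ with $\int_{\mathbb{Y}}f(y;x)\,dy=1$ for every $x\in\mathbb{X}$. For a probability measure $P$ on $\mathbb{X}$ the mixture density is $f_P(y)=\int_{\mathbb{X}}f(y;x)\,dP(x)$, identified with the probability measure $f_P(y)\,dy$ on $\mathbb{Y}$; thus $f_{\tilde P}$ is a random probability on $\mathbb{Y}$ when $\tilde P$ is one on $\mathbb{X}$. The family $\{f(\cdot;x)\}_x$ is identifiable if, for all $P_1,P_2\in\mathcal{P}(\mathbb{X})$, $f_{P_1}=f_{P_2}$ a.e. (w.r.t. $dy$) implies $P_1=P_2$. For a space $\mathbb{S}\in\{\mathbb{X},\mathbb{Y}\}$: $\mathcal{P}(\mathbb{S})$ is the set of probability measures on $\mathbb{S}$, with the $\sigma$-algebra generated by evaluations $\xi\mapsto\xi(A)$; a kernel on $\mathbb{S}$ is a measurable function $k:\mathbb{S}\times\mathbb{S}\to\mathbb{R}$ that is bounded, symmetric and positive-definite ($\sum_{i,j}a_ia_jk(s_i,s_j)\ge0$ for all finite families); $\mathbb{H}_k$ is its reproducing kernel Hilbert space; the kernel mean embedding of a finite signed measure $\xi$ is $\mu_k(\xi)\in\mathbb{H}_k$, $\mu_k(\xi)(t)=\int k(s,t)\,d\xi(s)$,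 with $\langle\mu_k(\xi_1),\mu_k(\xi_2)\rangle_{\mathbb{H}_k}=\iint k\,d\xi_1\,d\xi_2$; $k$ is characteristic if $\mu_k$ is injective on $\mathcal{P}(\mathbb{S})$. A random probability on $\mathbb{S}$ is a random element of $\mathcal{P}(\mathbb{S})$; it is deterministic if it is a.s. equal to a fixed probability measure; its mean measure is $\mathbb{E}[\tilde Q](A)=\mathbb{E}[\tilde Q(A)]$. $\mathrm{Cov}_k(\tilde Q_1,\tilde Q_2)=\mathbb{E}\big[\langle\mu_k(\tilde Q_1)-\mathbb{E}[\mu_k(\tilde Q_1)],\mu_k(\tilde Q_2)-\mathbb{E}[\mu_k(\tilde Q_2)]\rangle_{\mathbb{H}_k}\big]$, where $\mathbb{E}[V]$ is characterised by $\langle h,\mathbb{E}[V]\rangle=\mathbb{E}\langle h,V\rangle$ for all $h\in\mathbb{H}_k$; $\mathrm{Var}_k(\tilde Q)=\mathrm{Cov}_k(\tilde Q,\tilde Q)$; when both kernel variances are positive $\mathrm{Corr}_k(\tilde Q_1,\tilde Q_2)=\mathrm{Cov}_k(\tilde Q_1,\tilde Q_2)/\big(\sqrt{\mathrm{Var}_k(\tilde Q_1)}\sqrt{\mathrm{Var}_k(\tilde Q_2)}\big)$. $\mathrm{Corr},\mathrm{Cov},\mathrm{Var}$ without subscript are the usual ones for real random variables. *)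

(* Defs.v *)
From HB Require Import structures.
From mathcomp Require Import all_boot all_order all_algebra.
From mathcomp Require Import all_classical all_reals all_analysis.
From mathcomp Require Import measurable_realfun.

Set Implicit Arguments.
Unset Strict Implicit.
Unset Printing Implicit Defensive.

Import Order.TTheory GRing.Theory Num.Theory.
Import numFieldNormedType.Exports.

Local Open Scope classical_set_scope.
Local Open Scope ring_scope.

Notation borel T := (g_sigma_algebraType (@open T)).

Definition separable_space (T : topologicalType) : Prop :=
  exists2 D : set T, countable D & dense D.

Definition completely_metrizable (R : realType) (T : topologicalType) : Prop :=
  exists d : T -> T -> R,
  [/\ forall x y, 0 <= d x y,
      forall x y, d x y = 0 <-> x = y,
      forall x y, d x y = d y x
    & forall x y z, d x z <= d x y + d y z] /\
  [/\ forall U : set T, open U <->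
        (forall x, U x -> exists2 e : R, 0 < e & [set y | d x y < e] `<=` U)
    & forall u : nat -> T,
        (forall e : R, 0 < e -> exists N : nat, forall m n : nat,
           (N <= m)%N -> (N <= n)%N -> d (u m) (u n) < e) ->
        exists x : T, u @ \oo --> x].

(* Stated for existence of a complete metric: neither the metric nor the uniform
   structure is part of the data. *)
Definition polish (R : realType) (T : topologicalType) : Prop :=
  separable_space T /\ completely_metrizable R T.

(* Equality in the space of probability measures.  The library's measures are
   functions on all subsets, with unconstrained values outside the
   sigma-algebra, so Leibniz equality would be too strong. *)
Definition same_probability (R : realType) (d : measure_display)
    (S : measurableType d) (P Q : probability S R) : Prop :=
  forall A, measurable A -> P A = Q A.

Section random_probabilities.
Context (R : realType) (d d' : measure_display).
Context (Omega : measurableType d) (S : measurableType d').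
Variable Pr : probability Omega R.

Definition deterministic_prob (Q : Omega -> probability S R) : Prop :=
  exists P : probability S R, {ae Pr, forall w, same_probability (Q w) P}.

Definition deterministic_rv (U : Omega -> R) : Prop :=
  exists c : R, {ae Pr, forall w, U w = c}.

Definition mean_measure (Q : Omega -> probability S R) (A : set S) : \bar R :=
  (\int[Pr]_w Q w A)%E.

Definition eval_prob (Q : Omega -> probability S R) (A : set S) : Omega -> R :=
  fun w => fine (Q w A).

Definition correlation (U V : Omega -> R) : R :=
  fine (covariance Pr U V) /
    (Num.sqrt (fine ('V_Pr[U])%E) * Num.sqrt (fine ('V_Pr[V])%E)).

End random_probabilities.

Section kernels.
Context (R : realType) (d : measure_display) (S : measurableType d).

Definition is_kernel (k : S -> S -> R) : Prop :=
  [/\ measurable_fun [set: S * S] (fun z => k z.1 z.2),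
      (exists M : R, forall s t, `|k s t| <= M),
      (forall s t, k s t = k t s)
    & (forall (n : nat) (s : 'I_n -> S) (a : 'I_n -> R),
         0 <= \sum_(i < n) \sum_(j < n) a i * a j * k (s i) (s j))].

(* Kernel mean embedding, as a function on S. *)
Definition kme (k : S -> S -> R) (P : probability S R) : S -> R :=
  fun t => \int[P]_s k s t.

Definition characteristic (k : S -> S -> R) : Prop :=
  forall P Q : probability S R, kme k P = kme k Q -> same_probability P Q.

End kernels.

(* A Hilbert space of functions on S with reproducing kernel k.  The inner
   product is only meaningful on pairs of elements of the carrier; by the
   Moore-Aronszajn theorem, a positive-definite k determines the carrier and
   the inner product on it. *)
Record rkhs (R : realType) (S : Type) (k : S -> S -> R) := RKHS {
  rkhs_set : set (S -> R) ;
  rkhs_dot : (S -> R) -> (S -> R) -> R ;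
  rkhs_zero : rkhs_set (fun=> 0) ;
  rkhs_lin : forall (a : R) g h, rkhs_set g -> rkhs_set h ->
    rkhs_set (fun s => a * g s + h s) ;
  rkhs_dotC : forall g h, rkhs_set g -> rkhs_set h ->
    rkhs_dot g h = rkhs_dot h g ;
  rkhs_dotDl : forall (a : R) g1 g2 h,
    rkhs_set g1 -> rkhs_set g2 -> rkhs_set h ->
    rkhs_dot (fun s => a * g1 s + g2 s) h = a * rkhs_dot g1 h + rkhs_dot g2 h ;
  rkhs_dot_ge0 : forall h, rkhs_set h -> 0 <= rkhs_dot h h ;
  rkhs_dot_eq0 : forall h, rkhs_set h -> rkhs_dot h h = 0 -> h = (fun=> 0) ;
  rkhs_complete : forall u : nat -> S -> R, (forall n, rkhs_set (u n)) ->
    (forall e : R, 0 < e -> exists N : nat, forall m n : nat,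
       (N <= m)%N -> (N <= n)%N ->
       Num.sqrt (rkhs_dot (u m \- u n) (u m \- u n)) < e) ->
    exists2 h, rkhs_set h &
      Num.sqrt (rkhs_dot (u n \- h) (u n \- h)) @[n --> \oo] --> (0 : R) ;
  rkhs_section : forall s, rkhs_set (k s) ;
  rkhs_reproducing : forall h s, rkhs_set h -> rkhs_dot h (k s) = h s }.

Section kernel_covariance.
Context (R : realType) (d d' : measure_display).
Context (Omega : measurableType d) (S : measurableType d').
Variables (Pr : probability Omega R) (k : S -> S -> R) (H : rkhs k).

(* Weak (Pettis) expectation in the Hilbert space H; at most one m in H
   satisfies it. *)
Definition is_hmean (V : Omega -> S -> R) (m : S -> R) : Prop :=
  rkhs_set H m /\ forall h, rkhs_set H h ->
    (rkhs_dot H h m)%:E = ('E_Pr[fun w => rkhs_dot H h (V w)])%E.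

Definition hmean (V : Omega -> S -> R) : S -> R :=
  xget (fun=> 0) [set m | is_hmean V m].

Definition kcov (Q1 Q2 : Omega -> probability S R) : \bar R :=
  let V1 := fun w => kme k (Q1 w) in
  let V2 := fun w => kme k (Q2 w) in
  ('E_Pr[fun w => (rkhs_dot H (V1 w \- hmean V1) (V2 w \- hmean V2))%R])%E.

Definition kvar (Q : Omega -> probability S R) : \bar R := kcov Q Q.

Definition kcorr (Q1 Q2 : Omega -> probability S R) : R :=
  fine (kcov Q1 Q2) /
    (Num.sqrt (fine (kvar Q1)) * Num.sqrt (fine (kvar Q2))).

End kernel_covariance.

Record density_kernel (R : realType) (d d' : measure_display)
    (Y : measurableType d) (X : measurableType d')
    (nu : {sigma_finite_measure set Y -> \bar R}) := DensityKernel {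
  density :> Y -> X -> R ;
  density_measurable : measurable_fun [set: Y * X] (fun z => density z.1 z.2) ;
  density_ge0 : forall y x, 0 <= density y x ;
  density_int1 : forall x, (\int[nu]_y (density y x)%:E = 1)%E }.

Section mixtures.
Context (R : realType) (d d' : measure_display).
Context (Y : measurableType d) (X : measurableType d').
Context (nu : {sigma_finite_measure set Y -> \bar R}).
Variables (f : density_kernel X nu).

(* Extended-valued: it may be +oo on a nu-negligible set. *)
Definition mixture_density (P : probability X R) (y : Y) : \bar R :=
  (\int[P]_x (f y x)%:E)%E.

Definition mixture (P : probability X R) (A : set Y) : \bar R :=
  (\int[nu]_(y in A) mixture_density P y)%E.

Definition identifiable : Prop :=
  forall P1 P2 : probability X R,
    ae_eq nu setT (mixture_density P1) (mixture_density P2) ->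
    same_probability P1 P2.

(* The kernel written k_f, on the latent space. *)
Definition pullback_kernel (k : Y -> Y -> R) (x1 x2 : X) : R :=
  \int[(nu \x nu)%E]_z (k z.1 z.2 * f z.1 x1 * f z.2 x2).

Lemma mixture_density_ge0 P y : (0 <= mixture_density P y)%E.
Proof. by apply: integral_ge0 => x _; rewrite lee_fin density_ge0. Qed.

Lemma measurable_mixture_density P : measurable_fun setT (mixture_density P).
Proof.
apply: (@measurable_fun_fubini_tonelli_F _ _ _ _ _ P (fun z => (f z.1 z.2)%:E)) => //.
- by apply/measurable_EFinP; exact: density_measurable.
- by move=> z; rewrite lee_fin density_ge0.
Qed.

End mixtures.

Section mixture_probability.
Context (R : realType) (d d' : measure_display).
Context (Y : measurableType d) (X : measurableType d').
Context (nu : {sigma_finite_measure set Y -> \bar R}).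
Variables (f : density_kernel X nu) (P : probability X R).

Let mixture0 : mixture f P set0 = 0%E.
Proof. by rewrite /mixture integral_set0. Qed.

Let mixture_ge0 A : (0 <= mixture f P A)%E.
Proof. by apply: integral_ge0 => y _; exact: mixture_density_ge0. Qed.

Let mixture_sigma_additive : semi_sigma_additive (mixture f P).
Proof.
apply: semi_sigma_additive_nng_induced.
- exact: measurable_mixture_density.
- exact: mixture_density_ge0.
Qed.

HB.instance Definition _ := isMeasure.Build _ _ _ (mixture f P)
  mixture0 mixture_ge0 mixture_sigma_additive.

Let mixture1 : mixture f P setT = 1%E.
Proof.
rewrite /mixture /mixture_density.
rewrite (@fubini_tonelli _ _ _ _ _ nu P (fun z => (f z.1 z.2)%:E)) /=.
- under eq_integral do rewrite density_int1.
  rewrite integral_cst// mul1e; exact: probability_setT.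
- by apply/measurable_EFinP; exact: density_measurable.
- by move=> z; rewrite lee_fin density_ge0.
Qed.

HB.instance Definition _ :=
  Measure_isProbability.Build _ _ _ (mixture f P) mixture1.

Definition mixture_prob : probability Y R := mixture f P.

End mixture_probability.

(* Main.v *)
(* For a probability measure Q, mu_k(Q) lies in the RKHS H of k and <h, mu_k(Q)>
   is the integral of h against Q; the elements of H are measurable because
   the measurable ones form a closed subspace containing all sections of k.
   Hence Cov_k(Q1, Q2) = E[iint k dQ1 dQ2] - iint k dM1 dM2, with Mi the mean
   measure of Qi.  Polarising the hypothesis on Cov(P1(A), P2(A)) gives the
   symmetrised second moment measure of (P1, P2) on rectangles, so that, k_f
   being symmetric, Cov_{k_f}(P1, P2) = eta D and Var_{k_f}(Pi) = lambda_i D with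
   D = int k_f(x, x) dP0(x) - iint k_f dP0 dP0.  Mixing turns k into k_f, which
   gives the same values for f_{P1}, f_{P2}; and D > 0 since a zero kernel
   variance would, k being characteristic and f identifiable, make P1
   deterministic. *)
Require Import Defs.
From HB Require Import structures.
From mathcomp Require Import all_boot all_order all_algebra.
From mathcomp Require Import all_classical all_reals all_analysis.
From mathcomp Require Import measurable_realfun giry ring lra.

Set Implicit Arguments.
Unset Strict Implicit.
Unset Printing Implicit Defensive.

Import Order.TTheory GRing.Theory Num.Theory.
Import numFieldNormedType.Exports.

Local Open Scope classical_set_scope.
Local Open Scope ring_scope.

(** * Integrals of bounded measurable functions against probability measures *)

Section bounded_measurable.
Context (R : realType) (d : measure_display) (T : measurableType d).
Implicit Types (g h : T -> R) (P : probability T R).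

(** The integrands used throughout. They are integrable against every probability measure, so real
    integrals are linear on them without further side conditions. *)
Definition bdm g := measurable_fun setT g /\ exists M : R, forall x, `|g x| <= M.

Lemma bdm_ub g : bdm g -> exists2 M : R, 0 <= M & forall x, `|g x| <= M.
Proof.
move=> [_ [M gM]]; exists (Num.max 0 M); first by rewrite le_max lexx.
by move=> x; rewrite le_max gM orbT.
Qed.

Lemma bdm_cst c : bdm (fun=> c).
Proof. by split; [exact: measurable_cst|exists `|c|]. Qed.

Lemma bdmD g h : bdm g -> bdm h -> bdm (fun x => g x + h x).
Proof.
move=> [mg [M gM]] [mh [N hN]]; split; first exact: measurable_funD.
by exists (M + N) => x; rewrite (le_trans (ler_normD _ _))// lerD.
Qed.

Lemma bdmM g h : bdm g -> bdm h -> bdm (fun x => g x * h x).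
Proof.
move=> [mg [M gM]] [mh [N hN]]; split; first exact: measurable_funM.
by exists (M * N) => x; rewrite normrM ler_pM.
Qed.

Lemma bdmZ c g : bdm g -> bdm (fun x => c * g x).
Proof. by move=> bg; apply: bdmM => //; exact: bdm_cst. Qed.

Lemma bdmB g h : bdm g -> bdm h -> bdm (fun x => g x - h x).
Proof.
move=> bg bh; have /(bdmD bg) := bdmZ (-1) bh.
by under eq_fun do rewrite mulN1r.
Qed.

Lemma bdm_sum (I : Type) (r : seq I) (F : I -> T -> R) :
  (forall i, bdm (F i)) -> bdm (fun x => \sum_(i <- r) F i x).
Proof.
move=> bF; elim: r => [|i r IH].
  by under eq_fun do rewrite big_nil; exact: bdm_cst.
by under eq_fun do rewrite big_cons; exact: bdmD.
Qed.

Lemma bdm_integrable P g : bdm g -> P.-integrable setT (EFin \o g).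
Proof.
move=> [mg [M gM]]; apply: measurable_bounded_integrable => //.
  by rewrite -ge0_fin_numE//; exact: fin_num_measure.
exists M; split; first exact: num_real.
by move=> y My x _ /=; exact: le_trans (gM x) (ltW My).
Qed.

Lemma EFin_bdm_Rintegral P g : bdm g ->
  (\int[P]_x g x)%:E = (\int[P]_x (g x)%:E)%E.
Proof.
by move=> bg; rewrite fineK//; apply: integrable_fin_num => //; exact: bdm_integrable.
Qed.

Lemma bdm_RintegralD P g h : bdm g -> bdm h ->
  \int[P]_x (g x + h x) = \int[P]_x g x + \int[P]_x h x.
Proof. by move=> bg bh; rewrite RintegralD//; exact: bdm_integrable. Qed.

Lemma bdm_RintegralB P g h : bdm g -> bdm h ->
  \int[P]_x (g x - h x) = \int[P]_x g x - \int[P]_x h x.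
Proof. by move=> bg bh; rewrite RintegralB//; exact: bdm_integrable. Qed.

Lemma bdm_RintegralZ P c g : bdm g ->
  \int[P]_x (c * g x) = c * \int[P]_x g x.
Proof. by move=> bg; rewrite RintegralZl//; exact: bdm_integrable. Qed.

Lemma probability_Rintegral_cst P (c : R) : \int[P]_x c = c.
Proof. by rewrite Rintegral_cst//= [X in fine X](_ : _ = 1%E) ?mulr1//; exact: probability_setT. Qed.

Lemma bdm_Rintegral_sum P (I : Type) (r : seq I) (F : I -> T -> R) :
  (forall i, bdm (F i)) ->
  \int[P]_x (\sum_(i <- r) F i x) = \sum_(i <- r) \int[P]_x F i x.
Proof.
move=> bF; elim: r => [|i r IH].
  under eq_Rintegral do rewrite big_nil.
  by rewrite probability_Rintegral_cst big_nil.
under eq_Rintegral do rewrite big_cons.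
by rewrite bdm_RintegralD// ?IH ?big_cons//; exact: bdm_sum.
Qed.

Lemma bdm_le_Rintegral P g (M : R) : bdm g -> (forall x, `|g x| <= M) ->
  `|\int[P]_x g x| <= M.
Proof.
move=> bg gM; rewrite (le_trans (le_normr_Rintegral _ _))//.
  exact: bdm_integrable.
rewrite -[leRHS](probability_Rintegral_cst P); apply: le_Rintegral => //.
- have [mg [N gN]] := bg; apply: bdm_integrable; split.
    exact: measurableT_comp.
  by exists N => x; rewrite normr_id.
- exact/bdm_integrable/bdm_cst.
Qed.

End bounded_measurable.

Lemma bdm_comp (R : realType) d d' (T : measurableType d) (U : measurableType d')
    (g : U -> R) (f : T -> U) :
  measurable_fun setT f -> bdm g -> bdm (g \o f).
Proof.
move=> mf [mg [M gM]]; split; first exact: measurableT_comp.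
by exists M => x /=.
Qed.

(** * Random probability measures and integration against their mean measure *)

Section probability_kernels.
Context (R : realType) (d d' : measure_display).
Context (Omega : measurableType d) (S : measurableType d').

(** Stated for bare functions on any sample space, so that it also covers products, mixtures, and
    the family of likelihoods indexed by the latent space. *)
Definition measurable_prob (Q : Omega -> probability S R) : Prop :=
  forall A, measurable A -> measurable_fun setT (fun w => Q w A).

Definition is_mean (Pr : probability Omega R) (Q : Omega -> probability S R)
    (M : probability S R) : Prop :=
  forall A, measurable A -> mean_measure Pr Q A = M A.

Variable (Q : Omega -> probability S R).
Hypothesis mQ : measurable_prob Q.

Let Qg (w : Omega) : giry S R := Q w.

Lemma measurable_prob_giry : measurable_fun setT Qg.
Proof. exact: measurable_giry_codensity. Qed.

Lemma measurable_integral_prob (g : S -> \bar R) :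
  measurable_fun setT g -> (forall s, 0 <= g s)%E ->
  measurable_fun setT (fun w => \int[Q w]_s g s)%E.
Proof.
move=> mg g0; have := measurableT_comp (measurable_giry_int mg g0) measurable_prob_giry.
exact.
Qed.

Lemma bdm_Rintegral_prob (g : S -> R) : bdm g -> bdm (fun w => \int[Q w]_s g s).
Proof.
move=> bg; have [M M0 gM] := bdm_ub bg; split; last first.
  by exists M => w; exact: bdm_le_Rintegral.
(* Measurability in [w] is available for nonnegative integrands; adding the bound [M] reduces to
   that case. *)
rewrite (_ : (fun w => _) = fun w => fine (\int[Q w]_s (g s + M)%:E)%E - M).
  apply: measurable_funB => //; apply: measurableT_comp => //.
  apply: measurable_integral_prob.
    by apply/measurable_EFinP; apply: measurable_funD => //; case: bg.
  by move=> s; rewrite lee_fin; have := gM s; rewrite ler_norml => /andP[]; lra.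
apply/funext => w; rewrite -/(Rintegral _ _ _) bdm_RintegralD//; last exact: bdm_cst.
by rewrite probability_Rintegral_cst addrK.
Qed.

(** The mean measure is the monadic bind of [Pr] with [Q] in the Giry monad, and integration against
    a bind is iterated integration. *)
Lemma integral_mean (Pr : probability Omega R) (M : probability S R)
    (g : S -> \bar R) : is_mean Pr Q M ->
  measurable_fun setT g -> (forall s, 0 <= g s)%E ->
  (\int[M]_s g s = \int[Pr]_w \int[Q w]_s g s)%E.
Proof.
move=> QM mg g0.
rewrite -[RHS](giry_int_bind Pr measurable_prob_giry)//.
apply: eq_measure_integral => A mA _.
transitivity (mean_measure Pr Q A); first exact/esym/QM.
by rewrite /giry_bind /= giry_int_map//; exact: measurable_giry_ev.
Qed.

(** Adding a bound [C] of [g] to both sides reduces this to the nonnegative case [integral_mean]. *)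
Lemma Rintegral_mean (Pr : probability Omega R) (M : probability S R)
    (g : S -> R) : is_mean Pr Q M -> bdm g ->
  \int[M]_s g s = \int[Pr]_w \int[Q w]_s g s.
Proof.
move=> QM bg; have [C C0 gC] := bdm_ub bg.
have gC0 s : 0 <= g s + C.
  by have := gC s; rewrite ler_norml => /andP[]; lra.
have bgC : bdm (fun s => g s + C) by apply: bdmD => //; exact: bdm_cst.
apply: (@addIr _ C).
transitivity (\int[M]_s (g s + C)).
  by rewrite bdm_RintegralD ?probability_Rintegral_cst//; exact: bdm_cst.
transitivity (\int[Pr]_w (\int[Q w]_s g s + C)); last first.
  rewrite bdm_RintegralD ?probability_Rintegral_cst//; last exact: bdm_cst.
  exact: bdm_Rintegral_prob.
transitivity (\int[Pr]_w (\int[Q w]_s (g s + C))); last first.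
  apply: eq_Rintegral => w _.
  by rewrite bdm_RintegralD ?probability_Rintegral_cst//; exact: bdm_cst.
apply: EFin_inj; rewrite EFin_bdm_Rintegral// EFin_bdm_Rintegral; last first.
  exact: bdm_Rintegral_prob.
rewrite (integral_mean QM); last 2 first.
- by apply/measurable_EFinP; case: bgC.
- by move=> s; rewrite lee_fin.
by apply: eq_integral => w _; rewrite EFin_bdm_Rintegral.
Qed.

End probability_kernels.

(** * Hilbert space geometry: Cauchy-Schwarz, projection and Riesz representation *)

Section rkhs_geometry.
Context (R : realType) (S : Type) (k : S -> S -> R) (H : rkhs k).
Implicit Types (f g h : S -> R).
Local Notation dot := (rkhs_dot H).
Local Notation inH := (rkhs_set H).

Lemma rkhs_dot0l h : inH h -> dot (fun=> 0) h = 0.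
Proof.
move=> Hh; have := rkhs_dotDl 1 (rkhs_zero H) (rkhs_zero H) Hh.
rewrite (_ : (fun _ => _) = (fun=> 0)); last by apply/funext => s; rewrite mulr0 addr0.
lra.
Qed.

Lemma rkhs_dotZl (a : R) g h : inH g -> inH h ->
  dot (fun s => a * g s) h = a * dot g h.
Proof.
move=> Hg Hh; have := rkhs_dotDl a Hg (rkhs_zero H) Hh.
rewrite rkhs_dot0l// addr0 => <-; congr (dot _ h).
by apply/funext => s; rewrite addr0.
Qed.

Lemma rkhsZ (a : R) g : inH g -> inH (fun s => a * g s).
Proof.
move=> Hg; have := rkhs_lin a Hg (rkhs_zero H).
by congr (inH _); apply/funext => s; rewrite addr0.
Qed.

Lemma rkhs_comb (a b : R) g h : inH g -> inH h ->
  inH (fun s => a * g s + b * h s).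
Proof. by move=> Hg Hh; apply: rkhs_lin => //; exact: rkhsZ. Qed.

Lemma rkhs_dot_combl (a b : R) g h f : inH g -> inH h -> inH f ->
  dot (fun s => a * g s + b * h s) f = a * dot g f + b * dot h f.
Proof.
by move=> Hg Hh Hf; rewrite rkhs_dotDl ?rkhs_dotZl//; exact: rkhsZ.
Qed.

Lemma rkhs_dot_combr (a b : R) g h f : inH g -> inH h -> inH f ->
  dot f (fun s => a * g s + b * h s) = a * dot f g + b * dot f h.
Proof.
move=> Hg Hh Hf; rewrite rkhs_dotC//; last exact: rkhs_comb.
by rewrite rkhs_dot_combl// (rkhs_dotC Hg)// (rkhs_dotC Hh).
Qed.

Lemma rkhs_dot_comb_sqr (a b : R) g h : inH g -> inH h ->
  dot (fun s => a * g s + b * h s) (fun s => a * g s + b * h s) =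
  a ^+ 2 * dot g g + 2 * a * b * dot g h + b ^+ 2 * dot h h.
Proof.
move=> Hg Hh; rewrite rkhs_dot_combl//; last exact: rkhs_comb.
rewrite !rkhs_dot_combr// (rkhs_dotC Hh Hg); ring.
Qed.

Lemma sub_combE g h : g \- h = (fun s => 1 * g s + (-1) * h s).
Proof. by apply/funext => s /=; rewrite mul1r mulN1r. Qed.

Lemma rkhsB g h : inH g -> inH h -> inH (g \- h).
Proof. by move=> Hg Hh; rewrite sub_combE; exact: rkhs_comb. Qed.

Lemma rkhs_dotBl g h f : inH g -> inH h -> inH f ->
  dot (g \- h) f = dot g f - dot h f.
Proof. by move=> Hg Hh Hf; rewrite sub_combE rkhs_dot_combl// mul1r mulN1r. Qed.

Lemma rkhs_dotBr g h f : inH g -> inH h -> inH f ->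
  dot f (g \- h) = dot f g - dot f h.
Proof. by move=> Hg Hh Hf; rewrite sub_combE rkhs_dot_combr// mul1r mulN1r. Qed.

Lemma rkhs_cauchy_schwarz g h : inH g -> inH h ->
  dot g h ^+ 2 <= dot g g * dot h h.
Proof.
move=> Hg Hh; have [h0|h0] := eqVneq (dot h h) 0.
  have -> := rkhs_dot_eq0 Hh h0.
  by rewrite (rkhs_dotC Hg (rkhs_zero H)) rkhs_dot0l// expr0n/= mulr_ge0// rkhs_dot_ge0//; exact: rkhs_zero.
have hp : 0 < dot h h by rewrite lt_def h0 rkhs_dot_ge0.
(* The squared norm of [(h,h) g - (g,h) h] equals [(h,h)] times the difference of the two sides. *)
have := rkhs_dot_ge0 (rkhs_comb (dot h h) (- dot g h) Hg Hh).
rewrite rkhs_dot_comb_sqr// => le0.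
rewrite -subr_ge0 -(pmulr_rge0 _ hp); apply: le_trans le0 _.
by rewrite le_eqVlt; apply/orP; left; apply/eqP; ring.
Qed.

(* Minimising |w|^2 - 2 L w over W yields both the orthogonal projection onto
   the closure of W (L = dot h) and the Riesz representation (W = H). *)
Lemma rkhs_riesz (W : set (S -> R)) (L : (S -> R) -> R) (C : R) :
  W `<=` inH -> W (fun=> 0) ->
  (forall (a : R) g h, W g -> W h -> W (fun s => a * g s + h s)) ->
  (forall (a : R) g h, W g -> W h ->
     L (fun s => a * g s + h s) = a * L g + L h) ->
  (forall w, W w -> L w ^+ 2 <= C * dot w w) ->
  exists g, [/\ inH g, (forall w, W w -> dot g w = L w) &
    exists2 u : nat -> S -> R, forall n, W (u n) &
      Num.sqrt (dot (u n \- g) (u n \- g)) @[n --> \oo] --> (0 : R)].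
Proof.
move=> WH W0 Wlin Llin LC.
have L0 : L (fun=> 0) = 0.
  have := Llin 1 _ _ W0 W0.
  rewrite (_ : (fun _ => _) = (fun=> 0)); last by apply/funext => s; rewrite mulr0 addr0.
  lra.
have LZ a g : W g -> L (fun s => a * g s) = a * L g.
  move=> Wg; have := Llin a _ _ Wg W0; rewrite L0 addr0 => <-.
  by congr L; apply/funext => s; rewrite addr0.
have WZ a g : W g -> W (fun s => a * g s).
  move=> Wg; have := Wlin a _ _ Wg W0.
  by congr W; apply/funext => s; rewrite addr0.
have Wc a b g h : W g -> W h -> W (fun s => a * g s + b * h s).
  by move=> Wg Wh; apply: Wlin => //; exact: WZ.
have Lc a b g h : W g -> W h ->
    L (fun s => a * g s + b * h s) = a * L g + b * L h.
  by move=> Wg Wh; rewrite Llin ?LZ//; exact: WZ.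
pose J w := dot w w - 2 * L w.
(* With [N = (w,w)] and [l = L w], failure would give [N + |C| < 2 l], hence
   [(N + |C|)^2 < 4 l^2 <= 4 |C| N], contradicting [0 <= (N - |C|)^2]. *)
have Jlb w : W w -> - `|C| <= J w.
  move=> Ww; have := LC w Ww; have := rkhs_dot_ge0 (WH _ Ww).
  rewrite /J; set N := dot w w; set l := L w => N0 lC.
  rewrite leNgt; apply/negP => lt.
  have C0 : 0 <= `|C| by exact: normr_ge0.
  have lC' : l ^+ 2 <= `|C| * N.
    by apply: le_trans lC _; rewrite ler_wpM2r// ler_norm.
  have NC : N + `|C| < 2 * l by lra.
  have : (N + `|C|) ^+ 2 < (2 * l) ^+ 2 by rewrite ltrXn2r//; lra.
  have : 0 <= (N - `|C|) ^+ 2 by exact: sqr_ge0.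
  move: `|C| lC' {lt NC C0 lC} => c lC' sq; rewrite !expr2 in sq lC' *.
  lra.
pose JW := [set J w | w in W].
have JW_inf : has_inf JW.
  split; first by exists (J (fun=> 0)); exists (fun=> 0).
  by exists (- `|C|) => _ [w Ww <-]; exact: Jlb.
pose m := inf JW.
have mJ w : W w -> m <= J w.
  by move=> Ww; apply: ge_inf; [case: JW_inf|exists w].
have /choice[u uP] : forall n : nat, exists w, W w /\ J w < m + n.+1%:R^-1.
  move=> n; have e0 : 0 < (n.+1%:R^-1 : R) by rewrite invr_gt0.
  by have [_ [w Ww <-] lt] := inf_adherent e0 JW_inf; exists w.
(* Parallelogram law: the linear parts of [J] cancel. As the midpoint lies in [W], its [J] is at
   least [m], which makes the minimising sequence [u] Cauchy. *)
have para v w : W v -> W w ->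
    dot (v \- w) (v \- w) = 2 * J v + 2 * J w -
      4 * J (fun s => 2^-1 * v s + 2^-1 * w s).
  move=> Wv Ww; rewrite /J Lc// sub_combE !rkhs_dot_comb_sqr; [|exact: WH..].
  by field.
have uu i j : dot (u i \- u j) (u i \- u j) <= 2 * i.+1%:R^-1 + 2 * j.+1%:R^-1.
  have [Wi Ji] := uP i; have [Wj Jj] := uP j.
  rewrite para//; have := mJ _ (Wc 2^-1 2^-1 _ _ Wi Wj).
  move: (i.+1%:R^-1) (j.+1%:R^-1) Ji Jj => a b; lra.
have small (e : R) : 0 < e -> exists N, forall n, (N <= n)%N -> n.+1%:R^-1 < e.
  move=> e0; exists (Num.truncn e^-1).+1 => n Nn.
  rewrite invf_plt ?posrE//.
  apply: lt_le_trans (truncnS_gt _) _.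
  by rewrite ler_nat (leq_trans Nn).
have [|g Hg ug] := @rkhs_complete _ _ _ H u (fun n => WH _ (uP n).1).
  move=> e e0; have [|N NP] := small (e ^+ 2 / 4).
    by rewrite divr_gt0// exprn_gt0.
  exists N => i j Ni Nj.
  rewrite -(ger0_norm (ltW e0)) -sqrtr_sqr ltr_sqrt ?exprn_gt0//.
  apply: le_lt_trans (uu i j) _.
  by have := NP i Ni; have := NP j Nj; move: (i.+1%:R^-1) (j.+1%:R^-1) => a b; lra.
exists g; split => //; last by exists u => // n; exact: (uP n).1.
move=> w Ww; have Hw := WH _ Ww; set N := dot w w.
have N0 : 0 <= N by exact: rkhs_dot_ge0.
(* Approximate Euler equation: moving [u n] by [- D / (N + 1)] times [w] lowers [J] by at least
   [D^2 / (N + 1)], yet by less than [1 / (n + 1)]. Using [N + 1] instead of [N] avoids division by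
   zero. *)
have step n : (dot (u n) w - L w) ^+ 2 <= n.+1%:R^-1 * (N + 1).
  have [Wn Jn] := uP n; have Hn := WH _ Wn.
  move: n.+1%:R^-1 Jn => e Jn; set D := dot (u n) w - L w.
  have N1 : 0 < N + 1 by lra.
  have := mJ _ (Wc (N + 1) (- D) _ _ Wn Ww).
  have := mJ _ (Wc 1 (- D / (N + 1)) _ _ Wn Ww).
  rewrite /J Lc// rkhs_dot_comb_sqr// -/N.
  move: Jn; rewrite /J -/N => Jn h _.
  have {}h : m <= J (u n) + ( - (2 * D ^+ 2) * (N + 1)
       + D ^+ 2 * N) / (N + 1) ^+ 2.
    apply: le_trans h _; rewrite /J le_eqVlt; apply/orP; left; apply/eqP.
    by rewrite /D; field; rewrite gt_eqF.
  have : 0 <= e + ( - (2 * D ^+ 2) * (N + 1) + D ^+ 2 * N) / (N + 1) ^+ 2.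
    by move: h; rewrite /J; lra.
  rewrite -(pmulr_rge0 _ (exprn_gt0 2 N1)) mulrDr mulrCA divff ?mulr1; last first.
    by rewrite gt_eqF// exprn_gt0.
  have D0 : 0 <= D ^+ 2 by exact: sqr_ge0.
  move: (D ^+ 2) D0 => {h}D D0 h.
  have : 0 <= (N + 1) * (e * (N + 1) - D) by nra.
  by rewrite pmulr_rge0// subr_ge0.
apply/eqP; rewrite -subr_eq0 -sqrf_eq0 eq_le sqr_ge0 andbT.
apply/ler_addgt0Pl => e e0; rewrite addr0.
(* Chosen so that, for large [n], [(u n, w)] is within squared distance [e / 4] of both [(g, w)] and
   [L w]; then [(x - y)^2 <= 2 x^2 + 2 y^2] bounds the squared gap by [e]. *)
pose e1 := e / (4 * (N + 1)).
have N1 : 0 < N + 1 by lra.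
have e10 : 0 < e1 by rewrite divr_gt0// mulr_gt0.
have [M MP] := small _ e10.
have /cvgrPdist_lt /(_ (Num.sqrt e1)) := ug.
rewrite sqrtr_gt0 => /(_ e10) [M' _ M'P].
pose n := maxn M M'.
have /MP en : (M <= n)%N by exact: leq_maxl.
have /M'P /= : (M' <= n)%N by exact: leq_maxr.
rewrite sub0r normrN ger0_norm// ltr_sqrt// => ung.
have := step n; have Hn := WH _ (uP n).1.
have := rkhs_cauchy_schwarz (rkhsB Hn Hg) Hw.
rewrite rkhs_dotBl// -/N.
set a := dot (u n) w; set b := dot g w; set l := L w => h1 h2.
have h3 : (a - b) ^+ 2 <= e1 * (N + 1).
  apply: le_trans h1 _; apply: ler_pM => //; [|exact: ltW|lra].
  exact: rkhs_dot_ge0 (rkhsB Hn Hg).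
have h4 : (a - l) ^+ 2 <= e1 * (N + 1).
  by apply: le_trans h2 _; rewrite ler_pM2r// ltW.
have e1E : e1 * (N + 1) = e / 4 by rewrite /e1; field; rewrite gt_eqF.
rewrite e1E in h3 h4.
have : 0 <= (a - b + (a - l)) ^+ 2 by exact: sqr_ge0.
rewrite !expr2 in h3 h4 *; nra.
Qed.

End rkhs_geometry.

(** * Measurability in the RKHS and mean embeddings as its elements *)

Section kernel_sections.
Context (R : realType) (d : measure_display) (S : measurableType d).
Variables (k : S -> S -> R).
Hypothesis kk : is_kernel k.

Lemma kernel_bdm : bdm (fun z : S * S => k z.1 z.2).
Proof. by case: kk => mk [M kM] _ _; split => //; exists M. Qed.

Lemma kernel_sectionl s : bdm (k s).
Proof. exact: (bdm_comp (pair1_measurable s) kernel_bdm). Qed.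

Lemma kernel_diag : bdm (fun s => k s s).
Proof.
apply: (bdm_comp (f := fun s : S => (s, s)) _ kernel_bdm).
exact: measurable_fun_pair.
Qed.

Lemma bdm_kme (P : probability S R) : bdm (kme k P).
Proof.
have [mk [M kM] ksym _] := kk.
rewrite (_ : kme k P = fun t => \int[P]_s k t s); last first.
  by apply/funext => t; apply: eq_Rintegral => s _; rewrite ksym.
split; last by exists M => t; apply: bdm_le_Rintegral => //; exact: kernel_sectionl.
have C t : (\int[P]_s k t s)%:E = (fubini_F P (fun z : S * S => (k z.1 z.2)%:E)) t.
  by rewrite EFin_bdm_Rintegral//; exact: kernel_sectionl.
apply/measurable_EFinP.
rewrite (_ : EFin \o _ = fubini_F P (fun z : S * S => (k z.1 z.2)%:E)); last first.
  by apply/funext => t; exact: C.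
apply: (@measurable_fubini_F _ _ _ _ _ P P).
exact: (bdm_integrable (P \x P)%E kernel_bdm).
Qed.

(** The double integral of [k] against [P] and [Q]. It is the inner product of the two embeddings,
    written without an RKHS so that values for [k] and for its pullback can be compared directly. *)
Definition mmd_dot (P Q : probability S R) : R := \int[Q]_t kme k P t.

Variable H : rkhs k.
Local Notation dot := (rkhs_dot H).
Local Notation inH := (rkhs_set H).

Lemma rkhs_sqr_le M h s : (forall s t, `|k s t| <= M) -> inH h ->
  h s ^+ 2 <= M * dot h h.
Proof.
move=> kM Hh; rewrite -(rkhs_reproducing _ Hh).
apply: le_trans (rkhs_cauchy_schwarz Hh (rkhs_section H s)) _.
rewrite mulrC ler_wpM2r ?rkhs_dot_ge0//.
rewrite rkhs_reproducing; last exact: rkhs_section.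
exact: le_trans (ler_norm _) (kM _ _).
Qed.

Lemma rkhs_bdm h : inH h -> bdm h.
Proof.
move=> Hh; have [mk [M kM] ksym _] := kk; split; last first.
  exists (Num.sqrt (M * dot h h)) => s.
  by rewrite -sqrtr_sqr ler_wsqrtr// rkhs_sqr_le.
(* Here [g] is the orthogonal projection of [h] on the closure of the measurable elements. The
   sections of [k] are among these, so [g] and [h] agree at every point. *)
have [|||||g [Hg gW [u uW ug]]] := @rkhs_riesz _ _ _ H
  (inH `&` [set g | measurable_fun setT g]) (dot h) (dot h h).
- by move=> ? [].
- by split; [exact: rkhs_zero|exact: measurable_cst].
- move=> a g1 g2 [H1 m1] [H2 m2]; split; first exact: rkhs_lin.
  by apply: measurable_funD => //; apply: measurable_funM.
- move=> a g1 g2 [H1 _] [H2 _].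
  by rewrite (rkhs_dotC Hh)// ?rkhs_dotDl// 1?(rkhs_dotC H1)// 1?(rkhs_dotC H2)//; exact: rkhs_lin.
- by move=> w [Hw _]; exact: rkhs_cauchy_schwarz.
have gh : g = h.
  apply/funext => s; rewrite -(rkhs_reproducing _ Hg) -(rkhs_reproducing _ Hh).
  by apply: gW; split; [exact: rkhs_section|case: (kernel_sectionl s)].
rewrite {}gh in ug.
(* Norm convergence implies pointwise convergence, by Cauchy-Schwarz against [k s]; so [h] is a
   pointwise limit of measurable functions. The [+ 1] in [C] below keeps it positive when
   [k s s = 0]. *)
apply: (@measurable_fun_cvg _ _ _ _ u) => [n|s _]; first exact: (uW n).2.
apply/cvgrPdist_lt => e e0.
pose C := Num.sqrt (k s s) + 1.
have C0 : 0 < C by rewrite ltr_wpDl// sqrtr_ge0.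
have /cvgrPdist_lt /(_ (e / C)) := ug.
rewrite divr_gt0// => /(_ isT); apply: filterS => n /=.
have Hn := (uW n).1; have Hd := rkhsB Hn Hh.
rewrite sub0r normrN ger0_norm ?sqrtr_ge0// ltr_pdivlMr// => lt.
rewrite distrC; apply: le_lt_trans lt.
rewrite -[u n s - h s]/((u n \- h) s) -sqrtr_sqr -(rkhs_reproducing _ Hd).
apply: (@le_trans _ _ (Num.sqrt (dot (u n \- h) (u n \- h) * dot (k s) (k s)))).
  by rewrite ler_wsqrtr// rkhs_cauchy_schwarz//; exact: rkhs_section.
rewrite sqrtrM ?rkhs_dot_ge0// ler_wpM2l ?sqrtr_ge0//.
rewrite rkhs_reproducing; last exact: rkhs_section.
by rewrite /C lerDl.
Qed.

(** Integration against [P] is a functional on [H] whose square is at most [M] times the squared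
    norm. Its Riesz representer, evaluated by pairing with the sections of [k], is the embedding. *)
Lemma kme_rkhs (P : probability S R) :
  inH (kme k P) /\ forall h, inH h -> dot h (kme k P) = \int[P]_s h s.
Proof.
have [mk [M kM] ksym _] := kk.
have [|||||g [Hg gW _]] := @rkhs_riesz _ _ _ H inH (fun h => \int[P]_s h s) M.
- by [].
- exact: rkhs_zero.
- by move=> *; exact: rkhs_lin.
- move=> a g h /rkhs_bdm bg /rkhs_bdm bh.
  by rewrite bdm_RintegralD ?bdm_RintegralZ//; exact: bdmZ.
- move=> w Hw; have M0 : 0 <= M * dot w w.
    by apply: le_trans (rkhs_sqr_le point kM Hw); exact: sqr_ge0.
  rewrite -(sqr_sqrtr M0) -real_normK ?num_real// lerXn2r ?nnegrE ?sqrtr_ge0//.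
  apply: bdm_le_Rintegral; first exact: rkhs_bdm.
  by move=> s; rewrite -sqrtr_sqr ler_wsqrtr// rkhs_sqr_le.
suff -> : kme k P = g by split => // h Hh; rewrite (rkhs_dotC Hh)// gW.
apply/funext => t; rewrite -(rkhs_reproducing _ Hg) gW; last exact: rkhs_section.
by apply: eq_Rintegral => s _; rewrite ksym.
Qed.

Lemma mmd_dotE P Q : mmd_dot P Q = dot (kme k P) (kme k Q).
Proof. by have [HP _] := kme_rkhs P; rewrite (kme_rkhs Q).2. Qed.

End kernel_sections.

(** * Products of random probabilities and Fubini for bounded functions *)

Section product_kernels.
Context (R : realType) (d d1 d2 : measure_display) (Omega : measurableType d).
Context (S1 : measurableType d1) (S2 : measurableType d2).

Definition prod_prob (P : probability S1 R) (Q : probability S2 R) :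
  probability (S1 * S2)%type R := (P \x Q)%E.

Lemma measurable_prod_prob (Q1 : Omega -> probability S1 R)
    (Q2 : Omega -> probability S2 R) :
  measurable_prob Q1 -> measurable_prob Q2 ->
  measurable_prob (fun w => prod_prob (Q1 w) (Q2 w)).
Proof.
move=> m1 m2 A mA.
have mQ : measurable_fun setT (fun w => (Q1 w : giry S1 R, Q2 w : giry S2 R)).
  by apply: measurable_fun_pair; exact: measurable_prob_giry.
have := measurableT_comp (measurable_giry_ev mA)
  (measurableT_comp measurable_giry_prod mQ).
exact.
Qed.

Lemma prod_prob_Rintegral1 (P : probability S1 R) (Q : probability S2 R)
    (g : S1 * S2 -> R) : bdm g ->
  \int[prod_prob P Q]_z g z = \int[P]_x \int[Q]_y g (x, y).
Proof.
move=> bg; rewrite {1}/Rintegral -integral12_prod_meas1; last exact: bdm_integrable.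
congr fine; apply: eq_integral => x _; rewrite EFin_bdm_Rintegral//.
exact: (bdm_comp (pair1_measurable x)).
Qed.

Lemma prod_prob_Rintegral2 (P : probability S1 R) (Q : probability S2 R)
    (g : S1 * S2 -> R) : bdm g ->
  \int[prod_prob P Q]_z g z = \int[Q]_y \int[P]_x g (x, y).
Proof.
move=> bg; rewrite {1}/Rintegral -integral21_prod_meas1; last exact: bdm_integrable.
congr fine; apply: eq_integral => y _; rewrite EFin_bdm_Rintegral//.
exact: (bdm_comp (pair2_measurable y)).
Qed.

End product_kernels.

(** * Kernel covariances as differences of double integrals *)

Section kernel_covariance_formula.
Context (R : realType) (d d' : measure_display).
Context (Omega : measurableType d) (S : measurableType d').
Variables (Pr : probability Omega R) (k : S -> S -> R).
Hypothesis kk : is_kernel k.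

Lemma mmd_dot_prod (P Q : probability S R) :
  mmd_dot k P Q = \int[prod_prob P Q]_z k z.1 z.2.
Proof. by rewrite prod_prob_Rintegral2//; exact: kernel_bdm. Qed.

Lemma mmd_dotC (P Q : probability S R) : mmd_dot k P Q = mmd_dot k Q P.
Proof.
have [_ _ ksym _] := kk.
rewrite mmd_dot_prod prod_prob_Rintegral1; last exact: kernel_bdm.
apply: eq_Rintegral => x _; apply: eq_Rintegral => y _; exact: ksym.
Qed.

Lemma bdm_mmd_dot (Q1 Q2 : Omega -> probability S R) :
  measurable_prob Q1 -> measurable_prob Q2 ->
  bdm (fun w => mmd_dot k (Q1 w) (Q2 w)).
Proof.
move=> m1 m2; under eq_fun do rewrite mmd_dot_prod.
apply: bdm_Rintegral_prob; first exact: measurable_prod_prob.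
exact: kernel_bdm.
Qed.

Variable H : rkhs k.
Local Notation dot := (rkhs_dot H).

(** Pairing with [h] turns both sides into integrals of [h], related by [Rintegral_mean]. Testing
    against the sections of [k] shows uniqueness, so [xget] returns this element. *)
Lemma hmean_kme (Q : Omega -> probability S R) (M : probability S R) :
  measurable_prob Q -> is_mean Pr Q M ->
  hmean Pr H (fun w => kme k (Q w)) = kme k M.
Proof.
move=> mQ QM; have [HM dM] := kme_rkhs kk H M.
have mean : is_hmean Pr H (fun w => kme k (Q w)) (kme k M).
  split=> // h Hh; rewrite dM// (Rintegral_mean mQ QM); last exact: rkhs_bdm Hh.
  rewrite EFin_bdm_Rintegral; last exact: bdm_Rintegral_prob (rkhs_bdm kk Hh).
  rewrite unlock; apply: eq_integral => w _.
  by rewrite (kme_rkhs kk H (Q w)).2.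
apply: xget_unique => // m [Hm mE]; apply/funext => s.
rewrite -(rkhs_reproducing _ Hm) -(rkhs_reproducing _ HM).
have Hs := rkhs_section H s.
rewrite rkhs_dotC// (rkhs_dotC HM)//; apply: EFin_inj.
by rewrite mE// mean.2.
Qed.

(** Expand the centred inner product. Each cross term is linear in a single [Qi], so its expectation
    is the double integral against the two means. *)
Lemma kcovE (Q1 Q2 : Omega -> probability S R) (M1 M2 : probability S R) :
  measurable_prob Q1 -> measurable_prob Q2 ->
  is_mean Pr Q1 M1 -> is_mean Pr Q2 M2 ->
  kcov Pr H Q1 Q2 =
  (\int[Pr]_w mmd_dot k (Q1 w) (Q2 w) - mmd_dot k M1 M2)%:E.
Proof.
move=> m1 m2 QM1 QM2.
rewrite /kcov (hmean_kme m1 QM1) (hmean_kme m2 QM2) unlock.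
transitivity (\int[Pr]_w (mmd_dot k (Q1 w) (Q2 w) - \int[Q1 w]_t kme k M2 t
    - (\int[Q2 w]_t kme k M1 t - mmd_dot k M1 M2))%:E)%E.
  apply: eq_integral => w _; congr EFin.
  have [H1 d1] := kme_rkhs kk H (Q1 w); have [H2 d2] := kme_rkhs kk H (Q2 w).
  have [HM1 e1] := kme_rkhs kk H M1; have [HM2 e2] := kme_rkhs kk H M2.
  rewrite rkhs_dotBl//; last exact: rkhsB.
  rewrite !rkhs_dotBr// -!(mmd_dotE kk H) (mmd_dotC _ M2) /mmd_dot; ring.
have b12 := bdm_mmd_dot m1 m2.
have b1 : bdm (fun w => \int[Q1 w]_t kme k M2 t).
  exact: bdm_Rintegral_prob (bdm_kme kk M2).
have b2 : bdm (fun w => \int[Q2 w]_t kme k M1 t).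
  exact: bdm_Rintegral_prob (bdm_kme kk M1).
have bc := bdm_cst Omega (mmd_dot k M1 M2).
have ? := bdmB b12 b1; have ? := bdmB b2 bc.
rewrite -EFin_bdm_Rintegral; last exact: bdmB.
rewrite !bdm_RintegralB// probability_Rintegral_cst; congr EFin.
rewrite -(Rintegral_mean m1 QM1); last exact: bdm_kme.
rewrite -(Rintegral_mean m2 QM2); last exact: bdm_kme.
by rewrite -/(mmd_dot k M2 M1) -/(mmd_dot k M1 M2) (mmd_dotC M2); ring.
Qed.

(** The variance is the expectation of the squared distance from [kme k (Q w)] to [kme k M]; if it
    vanished, so would that distance almost surely. *)
Lemma kvar_gt0 (Q : Omega -> probability S R) (M : probability S R) :
  measurable_prob Q -> is_mean Pr Q M ->
  ~ {ae Pr, forall w, kme k (Q w) = kme k M} -> (0 < kvar Pr H Q)%E.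
Proof.
move=> mQ QM nae; rewrite lt_def; apply/andP; split; last first.
  rewrite /kvar /kcov; apply: expectation_ge0 => w.
  apply: rkhs_dot_ge0; apply: rkhsB; first exact: (kme_rkhs kk H _).1.
  by rewrite (hmean_kme mQ QM); exact: (kme_rkhs kk H _).1.
apply/eqP => v0; apply: nae.
pose D w := dot (kme k (Q w) \- kme k M) (kme k (Q w) \- kme k M).
have HQ w := (kme_rkhs kk H (Q w)).1; have HM := (kme_rkhs kk H M).1.
have HD w := rkhsB (HQ w) HM.
(* Written with double integrals, [D] is visibly bounded and measurable in [w]. *)
have DE : D = fun w => mmd_dot k (Q w) (Q w) - \int[Q w]_t kme k M t
    - (\int[Q w]_t kme k M t - mmd_dot k M M).
  apply/funext => w; rewrite /D rkhs_dotBl// !rkhs_dotBr// -!(mmd_dotE kk H).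
  by rewrite (mmd_dotC _ M) /mmd_dot; ring.
have bD : bdm D.
  rewrite DE; apply: bdmB; apply: bdmB; [exact: bdm_mmd_dot| | |exact: bdm_cst];
  exact: bdm_Rintegral_prob (bdm_kme kk M).
have /ae_eq_integral_abs : measurable_fun setT (EFin \o D).
  by apply/measurable_EFinP; case: bD.
move=> /(_ Pr measurableT) [+ _].
have -> : (\int[Pr]_w `|(EFin \o D) w| = 0)%E.
  move: v0; rewrite /kvar /kcov (hmean_kme mQ QM) unlock => v0.
  rewrite -[RHS]v0; apply: eq_integral => w _ /=.
  by rewrite ger0_norm// rkhs_dot_ge0.
move=> /(_ erefl); apply: filterS => w /(_ I) /= [D0].
have /funeqP e0 := rkhs_dot_eq0 (HD w) D0.
by apply/funext => t; apply/eqP; rewrite -subr_eq0; apply/eqP; exact: (e0 t).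
Qed.

End kernel_covariance_formula.

(** * The mean measure as a probability measure *)

Section mean_probability.
Context (R : realType) (d d' : measure_display).
Context (Omega : measurableType d) (S : measurableType d').
Variables (Pr : probability Omega R) (Q : Omega -> probability S R).
Hypothesis mQ : measurable_prob Q.

Let mean : set S -> \bar R := giry_bind Pr (measurable_prob_giry mQ).

HB.instance Definition _ := Measure.on mean.

Let meanE A : measurable A -> mean A = mean_measure Pr Q A.
Proof.
by move=> mA; rewrite /mean /giry_bind /= giry_int_map//; exact: measurable_giry_ev.
Qed.

Let mean1 : mean setT = 1%E.
Proof.
rewrite meanE// /mean_measure; under eq_integral do rewrite probability_setT.
by rewrite integral_cst// mul1e; exact: probability_setT.
Qed.

HB.instance Definition _ := Measure_isProbability.Build _ _ _ mean mean1.

Lemma mean_exists : exists M : probability S R, is_mean Pr Q M.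
Proof. by exists mean => A mA; rewrite -meanE. Qed.

End mean_probability.

(** * Evaluations at measurable sets and their covariances *)

Lemma fine_probabilityK (R : realType) d (T : measurableType d)
    (P : probability T R) A : measurable A -> (fine (P A))%:E = P A.
Proof. by move=> mA; rewrite fineK// fin_num_measure. Qed.

Section probability_evaluations.
Context (R : realType) (d d' : measure_display).
Context (Omega : measurableType d) (S : measurableType d').
Variables (Pr : probability Omega R).

Lemma eval_prob_bdm (Q : Omega -> probability S R) A :
  measurable_prob Q -> measurable A -> bdm (eval_prob Q A).
Proof.
move=> mQ mA; split; first by apply: measurableT_comp => //; exact: mQ.
exists 1 => w; rewrite /eval_prob ger0_norm ?fine_ge0//.
by rewrite -lee_fin fine_probabilityK// probability_le1.
Qed.

Lemma mean_eval_prob (Q : Omega -> probability S R) (M : probability S R) A :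
  is_mean Pr Q M -> measurable A -> \int[Pr]_w eval_prob Q A w = fine (M A).
Proof.
move=> QM mA; rewrite -QM//; congr fine; apply: eq_integral => w _.
by rewrite fine_probabilityK.
Qed.

Lemma eval_probU (Q : Omega -> probability S R) A B w :
  measurable A -> measurable B -> [disjoint A & B] ->
  eval_prob Q (A `|` B) w = eval_prob Q A w + eval_prob Q B w.
Proof.
move=> mA mB AB; rewrite /eval_prob measureU//; last exact/eqP/AB.
by rewrite fineD// fin_num_measure.
Qed.

Lemma covariance_bdm (X Y : Omega -> R) : bdm X -> bdm Y ->
  covariance Pr X Y =
  (\int[Pr]_w (X w * Y w) - \int[Pr]_w X w * \int[Pr]_w Y w)%:E.
Proof.
move=> bX bY; rewrite !unlock /=.
rewrite -/(Rintegral Pr setT X) -/(Rintegral Pr setT Y).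
set x := Rintegral _ _ X; set y := Rintegral _ _ Y.
transitivity (\int[Pr]_w (X w * Y w - x * Y w - (y * X w - x * y))%:E)%E.
  apply: eq_integral => w _; congr EFin.
  by rewrite -[LHS]/((X w - x) * (Y w - y)); ring.
have bXY := bdmM bX bY; have bxY := bdmZ x bY; have byX := bdmZ y bX.
have bc := bdm_cst Omega (x * y); have b1 := bdmB bXY bxY; have b2 := bdmB byX bc.
rewrite -EFin_bdm_Rintegral; last exact: bdmB.
congr EFin; rewrite !bdm_RintegralB// probability_Rintegral_cst.
by rewrite !bdm_RintegralZ// -/x -/y; ring.
Qed.

Lemma ae_eq0_Rintegral (X : Omega -> R) : bdm X -> (forall w, 0 <= X w) ->
  \int[Pr]_w X w = 0 -> {ae Pr, forall w, X w = 0}.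
Proof.
move=> bX X0 iX.
have mX : measurable_fun setT (EFin \o X) by apply/measurable_EFinP; case: bX.
have [+ _] := ae_eq_integral_abs Pr measurableT mX.
have -> : (\int[Pr]_w `|(EFin \o X) w| = 0)%E.
  rewrite -[RHS]/(0%R%:E) -iX EFin_bdm_Rintegral//; apply: eq_integral => w _ /=.
  by rewrite ger0_norm.
by move=> /(_ erefl); apply: filterS => w /(_ I) [].
Qed.

Lemma variance_eq0 (X : Omega -> R) : bdm X ->
  'V_Pr[X] = 0%E -> deterministic_rv Pr X.
Proof.
move=> bX V0; exists (\int[Pr]_w X w); set x := \int[Pr]_w X w.
have bXx : bdm (fun w => X w - x) by apply: bdmB => //; exact: bdm_cst.
have : {ae Pr, forall w, (X w - x) * (X w - x) = 0}.
  apply: ae_eq0_Rintegral; [exact: bdmM|by move=> w; rewrite -expr2 sqr_ge0|].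
  by move: V0; rewrite /variance !unlock => V0; rewrite /Rintegral -[RHS]/(fine 0%E) -V0.
by apply: filterS => w /eqP; rewrite mulf_eq0 orbb subr_eq0 => /eqP.
Qed.

End probability_evaluations.

Lemma Rintegral_dirac (R : realType) d (T : measurableType d) (a : T) (g : T -> R) :
  bdm g -> \int[\d_a]_x g x = g a.
Proof.
move=> [mg _]; rewrite /Rintegral integral_dirac ?diracT ?mul1e//.
exact/measurable_EFinP.
Qed.

(** * Measures on a product space determined by rectangles *)

Section rectangles.
Context (R : realType) (d : measure_display) (S : measurableType d).

(** Measurable rectangles are stable under intersection, generate the product sigma-algebra and
    include the whole space, which has finite measure. *)
Lemma eq_measure_rectangle (m1 m2 : {measure set (S * S) -> \bar R}) :
  (m1 setT < +oo)%E ->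
  (forall A B, measurable A -> measurable B -> m1 (A `*` B) = m2 (A `*` B)) ->
  forall E, measurable E -> m1 E = m2 E.
Proof.
move=> fin1 m12 E mE.
pose C := [set A `*` B | A in measurable & B in measurable] : set (set (S * S)).
apply: (measure_unique C (fun=> setT)) => //.
- exact: measurable_prod_measurableType.
- move=> _ _ [A1 mA1 [A2 mA2 <-]] [B1 mB1 [B2 mB2 <-]].
  exists (A1 `&` B1); first exact: measurableI.
  by exists (A2 `&` B2); [exact: measurableI|rewrite setXI].
- by move=> _; exists setT => //; exists setT => //; rewrite setXTT.
- by rewrite bigcup_const//; exists 0%N.
- by move=> _ [A mA [B mB <-]]; exact: m12.
Qed.

(* The two sides are rearranged so as to only add measures: this is where
   -1 <= eta <= 1 is used. *)
Lemma Rintegral_rectangle (m1 m2 D P : probability (S * S)%type R) (eta : R) :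
  -1 <= eta <= 1 ->
  (forall A B, measurable A -> measurable B ->
    fine (m1 (A `*` B)) + fine (m2 (A `*` B)) =
    2 * eta * fine (D (A `*` B)) + 2 * (1 - eta) * fine (P (A `*` B))) ->
  forall g : S * S -> R, bdm g ->
  \int[m1]_z g z + \int[m2]_z g z =
  2 * eta * \int[D]_z g z + 2 * (1 - eta) * \int[P]_z g z.
Proof.
move=> /andP[eta1 eta2] m12 g0 bg0; have [C C0 gC] := bdm_ub bg0.
(* The shift makes the integrand nonnegative. It preserves the identity since both sides have total
   mass 2. *)
pose g z := g0 z + C.
have bg : bdm g by apply: bdmD => //; exact: bdm_cst.
have gge0 z : (0 <= (g z)%:E)%E.
  by rewrite lee_fin /g; have := gC z; rewrite ler_norml => /andP[]; lra.
have gE (m : probability (S * S)%type R) : \int[m]_z g z = \int[m]_z g0 z + C.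
  by rewrite bdm_RintegralD ?probability_Rintegral_cst//; exact: bdm_cst.
suff : \int[m1]_z g z + \int[m2]_z g z + 2 * \int[D]_z g z =
    2 * (1 + eta) * \int[D]_z g z + 2 * (1 - eta) * \int[P]_z g z.
  by rewrite !gE; lra.
have c1 : 0 <= 2 * (1 + eta) by lra.
have c2 : 0 <= 2 * (1 - eta) by lra.
have c0 : 0 <= 2 :> R by lra.
pose l := measure_add (measure_add m1 m2) (mscale (NngNum c0) D).
pose r := measure_add (mscale (NngNum c1) D) (mscale (NngNum c2) P).
have mg : measurable_fun setT (EFin \o g) by apply/measurable_EFinP; case: bg.
apply: EFin_inj; rewrite !EFinD !(EFinM _ (Rintegral _ _ _)).
rewrite !EFin_bdm_Rintegral//.
transitivity (\int[l]_z (g z)%:E)%E.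
  by rewrite /l !ge0_integral_measure_add// ge0_integral_mscale.
transitivity (\int[r]_z (g z)%:E)%E; last first.
  by rewrite /r !ge0_integral_measure_add// !ge0_integral_mscale.
have lE E : measurable E ->
    l E = (fine (m1 E) + fine (m2 E) + 2 * fine (D E))%:E.
  move=> mE; transitivity (measure_add m1 m2 E + mscale (NngNum c0) D E)%E.
    exact: measure_addE.
  rewrite measure_addE.
  by rewrite /mscale /= !EFinD (EFinM 2) !fine_probabilityK.
have rE E : measurable E ->
    r E = (2 * (1 + eta) * fine (D E) + 2 * (1 - eta) * fine (P E))%:E.
  move=> mE; transitivity (mscale (NngNum c1) D E + mscale (NngNum c2) P E)%E.
    exact: measure_addE.
  by rewrite /mscale /= EFinD !(EFinM _ (fine _)) !fine_probabilityK.
apply: eq_measure_integral => E mE _.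
apply: (eq_measure_rectangle (m1 := l) (m2 := r)) => //; first by rewrite [ltLHS](lE _ measurableT) ltry.
move=> A B mA mB; have mAB := measurableX mA mB; rewrite [LHS](lE _ mAB) [RHS](rE _ mAB).
by congr EFin; have := m12 _ _ mA mB; lra.
Qed.

End rectangles.

(** * The symmetrised second moment measure of the pair *)

Section second_moments.
Context (R : realType) (d d' : measure_display).
Context (Omega : measurableType d) (S : measurableType d').
Variables (Pr : probability Omega R) (P1 P2 : Omega -> probability S R).
Variables (P0 : probability S R) (eta : R).
Hypotheses (mP1 : measurable_prob P1) (mP2 : measurable_prob P2).
Hypotheses (P1_mean : is_mean Pr P1 P0) (P2_mean : is_mean Pr P2 P0).
Hypothesis eta_bnd : -1 <= eta <= 1.
Hypothesis P12_cov : forall A, measurable A ->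
  (covariance Pr (eval_prob P1 A) (eval_prob P2 A) =
   eta%:E * P0 A * (1 - P0 A))%E.

Let p A := fine (P0 A).
Let m A B := \int[Pr]_w (eval_prob P1 A w * eval_prob P2 B w).

Let m_diag A : measurable A -> m A A = eta * p A * (1 - p A) + p A * p A.
Proof.
move=> mA; have := P12_cov mA.
have b1 := eval_prob_bdm mP1 mA; have b2 := eval_prob_bdm mP2 mA.
rewrite covariance_bdm// (mean_eval_prob P1_mean)// (mean_eval_prob P2_mean)//.
rewrite -(fine_probabilityK _ mA) -EFinB -!EFinM => -[] /eqP.
by rewrite subr_eq => /eqP.
Qed.

Let bmul A B : measurable A -> measurable B ->
  bdm (fun w => eval_prob P1 A w * eval_prob P2 B w).
Proof. by move=> mA mB; apply: bdmM; exact: eval_prob_bdm. Qed.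

Let m_addl A A' B : measurable A -> measurable A' -> measurable B ->
  [disjoint A & A'] -> m (A `|` A') B = m A B + m A' B.
Proof.
move=> mA mA' mB AA'; rewrite /m -bdm_RintegralD; [|exact: bmul..].
by apply: eq_Rintegral => w _; rewrite eval_probU// mulrDl.
Qed.

Let m_addr A B B' : measurable A -> measurable B -> measurable B' ->
  [disjoint B & B'] -> m A (B `|` B') = m A B + m A B'.
Proof.
move=> mA mB mB' BB'; rewrite /m -bdm_RintegralD; [|exact: bmul..].
by apply: eq_Rintegral => w _; rewrite eval_probU// mulrDr.
Qed.

Let pU A B : measurable A -> measurable B -> [disjoint A & B] ->
  p (A `|` B) = p A + p B.
Proof.
(* [P0] is treated as a constant random probability; the sample point is arbitrary. *)
by move=> mA mB AB; exact: (eval_probU (fun=> P0) (point : Omega) mA mB AB).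
Qed.

(** Expand [m_diag] at the union by biadditivity and subtract its values at [A] and at [B]. *)
Let m_disj A B : measurable A -> measurable B -> [disjoint A & B] ->
  m A B + m B A = 2 * (1 - eta) * p A * p B.
Proof.
move=> mA mB AB; have := m_diag (measurableU _ _ mA mB).
have mAB := measurableU _ _ mA mB.
rewrite m_addl// !m_addr// pU// !m_diag//; lra.
Qed.

(* Polarisation: only the symmetrised second moment is determined by the
   covariances at equal sets. *)
Let m_sym A B : measurable A -> measurable B ->
  m A B + m B A = 2 * eta * p (A `&` B) + 2 * (1 - eta) * (p A * p B).
Proof.
move=> mA mB; have mI := measurableI _ _ mA mB.
have mAB := measurableD mA mB; have mBA := measurableD mB mA.
have d1 : [disjoint A `&` B & A `\` B].
  by apply/disj_set2P; rewrite -subset0 => s [[_ Bs] [_ /(_ Bs)]].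
have d2 : [disjoint A `&` B & B `\` A].
  by apply/disj_set2P; rewrite -subset0 => s [[As _] [_ /(_ As)]].
have d3 : [disjoint A `\` B & B `\` A].
  by apply/disj_set2P; rewrite -subset0 => s [[As _] [_ /(_ As)]].
(* Cut both sets along their intersection. By biadditivity, [m_diag] handles the intersection paired
   with itself, and [m_disj] the three pairs of disjoint pieces. *)
have AE : A = (A `&` B) `|` (A `\` B) by rewrite setUIDK.
have BE : B = (A `&` B) `|` (B `\` A) by rewrite setIC setUIDK.
have -> : m A B = m ((A `&` B) `|` (A `\` B)) ((A `&` B) `|` (B `\` A)).
  by rewrite -AE -BE.
have -> : m B A = m ((A `&` B) `|` (B `\` A)) ((A `&` B) `|` (A `\` B)).
  by rewrite -AE -BE.
have -> : p A = p (A `&` B) + p (A `\` B) by rewrite -pU// -AE.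
have -> : p B = p (A `&` B) + p (B `\` A) by rewrite -pU// -BE.
have := m_diag mI; have := m_disj mI mAB d1; have := m_disj mI mBA d2.
have := m_disj mAB mBA d3.
rewrite !m_addl//; [|exact: measurableU..]; rewrite !m_addr//; lra.
Qed.

(** On rectangles the second moment measures in the two orders add up to [2 eta] times the law of
    [(s, s)], with [s] drawn from [P0], plus [2 (1 - eta)] times the square of [P0]. This extends to
    integrals of [k]. Taking [P1 = P2] also covers variances. *)
Lemma expected_mmd_dot (k : S -> S -> R) : is_kernel k ->
  \int[Pr]_w mmd_dot k (P1 w) (P2 w) =
  eta * \int[P0]_s k s s + (1 - eta) * mmd_dot k P0 P0.
Proof.
move=> kk; have bk := kernel_bdm kk.
have mQ12 := measurable_prod_prob mP1 mP2.
have mQ21 := measurable_prod_prob mP2 mP1.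
have mdiag : measurable_prob (fun s : S => \d_(s, s) : probability (S * S)%type R).
  move=> E mE; have mf : measurable_fun setT (fun s : S => (s, s)).
    exact: measurable_fun_pair.
  exact: (measurableT_comp (measurable_fun_dirac mE) mf).
have [M12 M12E] := mean_exists Pr mQ12; have [M21 M21E] := mean_exists Pr mQ21.
have [D DE] := mean_exists P0 mdiag.
have rect A B : measurable A -> measurable B ->
    fine (M12 (A `*` B)) + fine (M21 (A `*` B)) =
    2 * eta * fine (D (A `*` B)) + 2 * (1 - eta) * fine (prod_prob P0 P0 (A `*` B)).
  move=> mA mB; have mAB := measurableX mA mB; have mI := measurableI _ _ mA mB.
  rewrite -M12E// -M21E// -DE//.
  have -> : fine (mean_measure Pr (fun w => prod_prob (P1 w) (P2 w)) (A `*` B)) = m A B.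
    congr fine; apply: eq_integral => w _.
    by rewrite [LHS]product_measure1E// EFinM !fine_probabilityK.
  have -> : fine (mean_measure Pr (fun w => prod_prob (P2 w) (P1 w)) (A `*` B)) = m B A.
    congr fine; apply: eq_integral => w _.
    by rewrite [LHS]product_measure1E// EFinM !fine_probabilityK// muleC.
  have -> : fine (mean_measure P0 (fun s : S => \d_(s, s)) (A `*` B)) = p (A `&` B).
    congr fine; transitivity (\int[P0]_s (\1_(A `&` B) s)%:E)%E; last first.
      by rewrite integral_indic ?setIT.
    apply: eq_integral => s _; rewrite /= diracE indicE.
    by congr (_%:R%:E); congr nat_of_bool; apply/idP/idP; rewrite !inE.
  have -> : fine (prod_prob P0 P0 (A `*` B)) = p A * p B.
    by rewrite [X in fine X]product_measure1E// fineM ?fin_num_measure.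
  exact: m_sym.
have := Rintegral_rectangle eta_bnd rect bk.
rewrite (Rintegral_mean mQ12 M12E)// (Rintegral_mean mQ21 M21E)//.
rewrite (Rintegral_mean mdiag DE)// -mmd_dot_prod//.
under eq_Rintegral do rewrite -mmd_dot_prod//.
(* Symmetry of [k] makes the integrals for the two orders equal, so the identity is twice the
   claim. *)
under [X in _ + X]eq_Rintegral do rewrite -mmd_dot_prod// mmd_dotC//.
under [X in _ = _ * X + _]eq_Rintegral do rewrite (Rintegral_dirac _ bk).
set a := Rintegral _ _ _; set b := Rintegral _ _ _; set c := mmd_dot _ _ _; lra.
Qed.

End second_moments.

(** * Integration against a measure given by a density *)

Section simple_function_approximation.
Import HBNNSimple.

(** The hypothesis on [m] is the case of indicators; linearity gives simple functions and monotone
    convergence the rest. *)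
Lemma ge0_integral_density (R : realType) d (T : measurableType d)
    (mu m : {measure set T -> \bar R}) (rho : T -> R) :
  measurable_fun setT rho -> (forall x, 0 <= rho x) ->
  (forall A, measurable A -> m A = \int[mu]_(x in A) (rho x)%:E)%E ->
  forall g : T -> \bar R, measurable_fun setT g -> (forall x, 0 <= g x)%E ->
  (\int[m]_x g x = \int[mu]_x (g x * (rho x)%:E))%E.
Proof.
move=> mrho rho0 mE g mg g0.
pose h := nnsfun_approx measurableT mg.
have hg x : (h n x)%:E @[n --> \oo] --> g x by exact: cvg_nnsfun_approx.
have -> : (\int[m]_x g x = limn (fun n => \int[m]_x (h n x)%:E))%E.
  rewrite -monotone_convergence//.
  - by apply: eq_integral => x _; apply/esym/cvg_lim => //; exact: hg.
  - by move=> n; exact/measurable_EFinP.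
  - by move=> n x _; rewrite lee_fin.
  - by move=> x _ a b ab; rewrite lee_fin; exact/lefP/nd_nnsfun_approx.
have -> : (\int[mu]_x (g x * (rho x)%:E) =
    limn (fun n => \int[mu]_x ((h n x)%:E * (rho x)%:E)))%E.
  rewrite -monotone_convergence//.
  - apply: eq_integral => x _; apply/esym/cvg_lim => //.
    by apply: cvgeZr => //; exact: hg.
  - by move=> n; apply: emeasurable_funM; exact/measurable_EFinP.
  - by move=> n x _; rewrite mule_ge0// lee_fin.
  - move=> x _ a b ab; rewrite lee_wpmul2r ?lee_fin//.
    exact/lefP/nd_nnsfun_approx.
apply: congr_lim; apply/funext => n.
rewrite integralT_nnsfun sintegralE.
transitivity (\int[mu]_x (\sum_(y \in range (h n))
    (y * \1_(h n @^-1` [set y]) x)%:E * (rho x)%:E))%E; last first.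
  apply: eq_integral => x _; rewrite -ge0_mule_fsuml; last first.
    by move=> y; exact: nnfun_muleindic_ge0.
  by rewrite fsumEFin// -(fimfunE _ x).
rewrite ge0_integral_fsum//; last 2 first.
- move=> y; apply: emeasurable_funM; apply/measurable_EFinP => //.
  exact: measurable_funM.
- by move=> y x _; rewrite mule_ge0 ?nnfun_muleindic_ge0 ?lee_fin.
apply: eq_fsbigr => y /[!inE] -[x0 _ <-].
rewrite mE//; under [RHS]eq_integral do rewrite EFinM -muleA.
rewrite ge0_integralZl//; last 3 first.
- by apply: emeasurable_funM; apply/measurable_EFinP => //; exact: measurable_indic.
- by move=> x _; rewrite mule_ge0 ?lee_fin.
- by rewrite lee_fin.
congr (_ * _)%E; rewrite integral_mkcond; apply: eq_integral => x _.
rewrite patchE indicE; case: ifPn => _; by rewrite ?mul1e ?mul0e.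
Qed.

End simple_function_approximation.

Lemma Rintegral_density (R : realType) d (T : measurableType d)
    (mu : {measure set T -> \bar R}) (m : probability T R) (rho : T -> R) :
  measurable_fun setT rho -> (forall x, 0 <= rho x) ->
  (forall A, measurable A -> m A = \int[mu]_(x in A) (rho x)%:E)%E ->
  forall g : T -> R, bdm g ->
  mu.-integrable setT (fun x => (g x * rho x)%:E) /\
  \int[m]_x g x = \int[mu]_x (g x * rho x).
Proof.
move=> mrho rho0 mE g bg; have [C C0 gC] := bdm_ub bg.
have mEge0 := ge0_integral_density mrho rho0 mE.
have irho : mu.-integrable setT (EFin \o rho).
  apply/integrableP; split; first exact/measurable_EFinP.
  under eq_integral do rewrite /= ger0_norm//.
  by rewrite -mE// ltey_eq fin_num_measure.
have ig : mu.-integrable setT (fun x => (g x * rho x)%:E).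
  apply: (@le_integrable _ _ _ mu setT measurableT _ (fun x => C%:E * (rho x)%:E)%E).
  - by apply/measurable_EFinP; apply: measurable_funM => //; case: bg.
  - move=> x _; rewrite -EFinM /= lee_fin !normrM ler_wpM2r//.
    by rewrite (ger0_norm C0).
  - exact: integrableZl.
split => //.
have gC0 x : 0 <= g x + C by have := gC x; rewrite ler_norml => /andP[]; lra.
have bgC : bdm (fun x => g x + C) by apply: bdmD => //; exact: bdm_cst.
apply: (@addIr _ C).
transitivity (\int[m]_x (g x + C)).
  by rewrite bdm_RintegralD ?probability_Rintegral_cst//; exact: bdm_cst.
apply: EFin_inj; rewrite EFin_bdm_Rintegral// mEge0; last 2 first.
- by apply/measurable_EFinP; case: bgC.
- by move=> x; rewrite lee_fin.
transitivity (\int[mu]_x ((g x * rho x)%:E + C%:E * (rho x)%:E))%E.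
  by apply: eq_integral => x _; rewrite -EFinM mulrDl EFinD EFinM.
rewrite integralD//; last exact: integrableZl.
rewrite EFinD fineK; last exact: integrable_fin_num.
congr (_ + _)%E; rewrite integralZl// -mE// -[RHS]mule1; congr (_ * _)%E.
exact: probability_setT.
Qed.

(** * Positive definiteness of the averaged kernel on probability measures *)

Section positive_definite_mean.
Context (R : realType) (d : measure_display) (S : measurableType d).
Variables (k : S -> S -> R).
Hypothesis kk : is_kernel k.

Let K (s : seq (R * S)) := \sum_(x <- s) \sum_(y <- s) x.1 * y.1 * k x.2 y.2.
Let L (s : seq (R * S)) (p : R * probability S R) :=
  \sum_(x <- s) x.1 * p.1 * kme k p.2 x.2.
Let J (p q : R * probability S R) := p.1 * q.1 * mmd_dot k p.2 q.2.
(** Correction for a random point paired with itself: one sample contributes [k y y], whereas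
    [J p p] accounts for two independent samples. *)
Let D (p : R * probability S R) :=
  p.1 ^+ 2 * (\int[p.2]_y k y y - mmd_dot k p.2 p.2).

Let K_ge0 s : 0 <= K s.
Proof.
have [_ _ _ psd] := kk.
rewrite /K big_tnth; under eq_bigr do rewrite big_tnth.
exact: (psd _ (fun i => (tnth (in_tuple s) i).2) (fun i => (tnth (in_tuple s) i).1)).
Qed.

Let K_cons a y s :
  K ((a, y) :: s) = K s + (a ^+ 2 * k y y + 2 * \sum_(x <- s) x.1 * a * k x.2 y).
Proof.
have [_ _ ksym _] := kk.
rewrite /K big_cons big_cons; under [X in _ + X]eq_bigr do rewrite big_cons.
rewrite big_split /=.
have -> : \sum_(x <- s) a * x.1 * k y x.2 = \sum_(x <- s) x.1 * a * k x.2 y.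
  by apply: eq_bigr => x _; rewrite ksym (mulrC a).
ring.
Qed.

(* K s + 2 \sum_p L s p + \sum_(p, q) J p q + \sum_p D p is the expectation of
   the quadratic form of k at the fixed weighted points s together with one
   independent random point of law p.2 and weight p.1 for each p in r. *)
Let sample_ge0 (r : seq (R * probability S R)) (s : seq (R * S)) :
  0 <= K s + 2 * \sum_(p <- r) L s p + \sum_(p <- r) \sum_(q <- r) J p q +
       \sum_(p <- r) D p.
Proof.
have [_ _ ksym _] := kk.
elim: r s => [|[a P] r IH] s; first by rewrite !big_nil mulr0 !addr0; exact: K_ge0.
set E0 := K s + 2 * \sum_(p <- r) L s p + \sum_(p <- r) \sum_(q <- r) J p q +
       \sum_(p <- r) D p.
have bd := kernel_diag kk; have bdiag := bdmZ (a ^+ 2) bd.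
have bk x : bdm (fun y => x.1 * a * k x.2 y).
  by apply: bdmZ; exact: kernel_sectionl.
have bL q : bdm (fun y => a * q.1 * kme k q.2 y).
  by apply: bdmZ; exact: bdm_kme.
have bsk := bdm_sum s bk; have bsL := bdm_sum r bL.
have bks := bdmZ 2 bsk; have bLr := bdmZ 2 bsL.
have bc := bdm_cst S E0.
have b1 := bdmD bdiag bks; have b2 := bdmD b1 bLr.
(* Fix the value [y] of the point of law [P], apply the induction hypothesis with [(a, y)] added to
   the fixed points, and integrate over [y]. *)
have : 0 <= \int[P]_y (E0 + (a ^+ 2 * k y y + 2 * \sum_(x <- s) x.1 * a * k x.2 y
    + 2 * \sum_(q <- r) a * q.1 * kme k q.2 y)).
  apply: Rintegral_ge0 => y _; have := IH ((a, y) :: s).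
  have -> : \sum_(p <- r) L ((a, y) :: s) p =
      \sum_(q <- r) a * q.1 * kme k q.2 y + \sum_(q <- r) L s q.
    by under eq_bigr do rewrite /L big_cons; rewrite big_split.
  by rewrite K_cons /E0; congr (0 <= _); ring.
rewrite bdm_RintegralD// probability_Rintegral_cst.
rewrite !bdm_RintegralD// (bdm_RintegralZ _ _ bd) (bdm_RintegralZ _ _ bsk).
rewrite (bdm_RintegralZ _ _ bsL) (bdm_Rintegral_sum _ _ bk) (bdm_Rintegral_sum _ _ bL).
have -> : \sum_(x <- s) \int[P]_y (x.1 * a * k x.2 y) = L s (a, P).
  apply: eq_bigr => x _; rewrite bdm_RintegralZ; last exact: kernel_sectionl.
  by congr (_ * _); apply: eq_Rintegral => y _; rewrite ksym.
have -> : \sum_(q <- r) \int[P]_y (a * q.1 * kme k q.2 y) = \sum_(q <- r) J (a, P) q.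
  apply: eq_bigr => q _; rewrite bdm_RintegralZ; last exact: bdm_kme.
  by rewrite /J /= (mmd_dotC kk P).
have JE : \sum_(p <- r) \sum_(q <- (a, P) :: r) J p q =
    \sum_(q <- r) J (a, P) q + \sum_(p <- r) \sum_(q <- r) J p q.
  under eq_bigr do rewrite big_cons.
  rewrite big_split /=; congr (_ + _); apply: eq_bigr => q _.
  by rewrite /J /= (mmd_dotC kk P) (mulrC a).
rewrite big_cons [X in _ -> 0 <= _ + X + _]big_cons JE !big_cons.
rewrite /E0 /D /J /=; lra.
Qed.

(* Apply sample_ge0 to N copies of the family: the off-diagonal terms grow like
   N^2 and the diagonal ones like N. *)
Lemma mmd_dot_psd n (P : 'I_n -> probability S R) (a : 'I_n -> R) :
  0 <= \sum_(i < n) \sum_(j < n) a i * a j * mmd_dot k (P i) (P j).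
Proof.
pose l := [seq (a i, P i) | i <- index_enum 'I_n].
set B := \sum_(i < n) _.
have BE : B = \sum_(p <- l) \sum_(q <- l) J p q.
  by rewrite /l big_map; apply: eq_bigr => i _; rewrite big_map.
have sumN N (F : R * probability S R -> R) :
    \sum_(p <- flatten (nseq N l)) F p = N%:R * \sum_(p <- l) F p.
  elim: N => [|N IH]; first by rewrite big_nil mul0r.
  by rewrite /= big_cat /= IH -natr1; ring.
pose C := \sum_(p <- l) D p.
have NBC N : 0 <= N%:R * (N%:R * B + C).
  have := sample_ge0 (flatten (nseq N l)) [::].
  rewrite /K big_nil; under eq_bigr do rewrite /L big_nil.
  rewrite big1// mulr0 !add0r !sumN.
  have -> : \sum_(p <- l) \sum_(q <- flatten (nseq N l)) J p q = N%:R * B.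
    by rewrite BE mulr_sumr; apply: eq_bigr => p _; exact: sumN.
  by rewrite -/C mulrDr.
rewrite leNgt; apply/negP => B0.
(* Large enough that the negative term [N * B] outweighs [C]. *)
pose N := (Num.truncn (`|C| / - B)).+1.
have CN : `|C| < N%:R * - B by rewrite -ltr_pdivrMr ?oppr_gt0// truncnS_gt.
have := NBC N; rewrite pmulr_rge0 ?ltr0n// leNgt => /negP; apply.
have := ler_norm C; move: CN; rewrite mulrN; lra.
Qed.

End positive_definite_mean.

(** * The likelihood kernel and the pullback of [k] to the latent space *)

Section likelihood_kernel.
Context (R : realType) (d d' : measure_display).
Context (Y : measurableType d) (X : measurableType d').
Context (nu : {sigma_finite_measure set Y -> \bar R}).
Variables (f : density_kernel X nu).

(** The law with density [f(.; x)]. Taking it as the mixture over a Dirac mass reuses the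
    probability structure on mixtures. *)
Definition likelihood (x : X) : probability Y R := mixture_prob f \d_x.

Let mf1 y : measurable_fun setT (f y).
Proof. exact: (measurableT_comp (density_measurable f) (pair1_measurable y)). Qed.

Let mf2 x : measurable_fun setT (f^~ x).
Proof. exact: (measurableT_comp (density_measurable f) (pair2_measurable x)). Qed.

Lemma likelihoodE x A : likelihood x A = (\int[nu]_(y in A) (f y x)%:E)%E.
Proof.
apply: eq_integral => y _; rewrite /mixture_density integral_dirac ?diracT ?mul1e//.
exact/measurable_EFinP.
Qed.

Let fA A (z : Y * X) : \bar R := ((f z.1 z.2)%:E * (\1_A z.1)%:E)%E.

Let mfA A : measurable A -> measurable_fun setT (fA A).
Proof.
move=> mA; apply: emeasurable_funM; apply/measurable_EFinP.
  exact: density_measurable.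
exact: (measurableT_comp (measurable_indic mA) measurable_fst).
Qed.

Let fA_ge0 A z : (0 <= fA A z)%E.
Proof. by rewrite mule_ge0 ?lee_fin// density_ge0. Qed.

Let likelihood_fubini x A : likelihood x A = (\int[nu]_y fA A (y, x))%E.
Proof. by rewrite likelihoodE integral_mkcond epatch_indic. Qed.

Lemma measurable_likelihood : measurable_prob likelihood.
Proof.
move=> A mA; under eq_fun do rewrite likelihood_fubini.
exact: (measurable_fun_fubini_tonelli_G (m1 := nu) _ (mfA mA) (@fA_ge0 A)).
Qed.

(** By Tonelli, mixing is averaging the likelihoods with the latent space as sample space, so the
    results on mean measures apply to mixtures. *)
Lemma likelihood_mean (P : probability X R) :
  is_mean P likelihood (mixture_prob f P).
Proof.
move=> A mA; rewrite /mean_measure; under eq_integral do rewrite likelihood_fubini.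
transitivity (\int[nu]_y \int[P]_x fA A (y, x))%E.
  exact: esym (fubini_tonelli (m1 := nu) (m2 := P) _ (mfA mA) (@fA_ge0 A)).
rewrite [RHS]integral_mkcond epatch_indic; apply: eq_integral => y _.
rewrite /mixture_density -ge0_integralZr//.
- by apply/measurable_EFinP; exact: mf1.
- by move=> x _; rewrite lee_fin density_ge0.
- by rewrite lee_fin.
Qed.

Lemma measurable_mixture_prob d0 (Omega : measurableType d0)
    (Q : Omega -> probability X R) :
  measurable_prob Q -> measurable_prob (fun w => mixture_prob f (Q w)).
Proof.
move=> mQ A mA; under eq_fun do rewrite -(likelihood_mean _ mA).
exact: (measurable_integral_prob mQ (measurable_likelihood mA)).
Qed.

Lemma mixture_prob_mean d0 (Omega : measurableType d0) (Pr : probability Omega R)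
    (Q : Omega -> probability X R) (M : probability X R) :
  measurable_prob Q -> is_mean Pr Q M ->
  is_mean Pr (fun w => mixture_prob f (Q w)) (mixture_prob f M).
Proof.
move=> mQ QM A mA; rewrite -(likelihood_mean _ mA) /mean_measure.
rewrite (integral_mean mQ QM)//; last exact: measurable_likelihood.
by apply: eq_integral => w _; rewrite -(likelihood_mean _ mA).
Qed.

Variable k : Y -> Y -> R.
Hypothesis kk : is_kernel k.

(** The product of the two likelihoods has density [f z.1 x1 * f z.2 x2] with respect to [nu \x nu].
    In this form the kernel properties of the pullback follow from those of [mmd_dot]. *)
Lemma pullback_kernelE x1 x2 :
  pullback_kernel f k x1 x2 = mmd_dot k (likelihood x1) (likelihood x2).
Proof.
pose rho (z : Y * Y) := f z.1 x1 * f z.2 x2.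
have mrho : measurable_fun setT rho.
  apply: measurable_funM.
    exact: (measurableT_comp (mf2 x1) measurable_fst).
  exact: (measurableT_comp (mf2 x2) measurable_snd).
have rho0 z : 0 <= rho z by rewrite mulr_ge0 ?density_ge0.
suff mE A : measurable A -> prod_prob (likelihood x1) (likelihood x2) A =
    (\int[(nu \x nu)%E]_(z in A) (rho z)%:E)%E.
  have [_ E] := Rintegral_density mrho rho0 mE (kernel_bdm kk).
  by rewrite mmd_dot_prod// E; apply: eq_Rintegral => z _; rewrite mulrA.
move=> mA.
have mI : measurable_fun setT (EFin \o \1_A : Y * Y -> \bar R).
  by apply/measurable_EFinP; exact: measurable_indic.
have I0 (z : Y * Y) : (0 <= (\1_A z : R)%:E)%E by rewrite lee_fin.
have lE x := ge0_integral_density (mf2 x) (density_ge0 f ^~ x)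
  (fun B _ => likelihoodE x B).
(* Compare both sides through iterated integrals of the indicator of [A], replacing each likelihood
   by its density in turn. *)
transitivity (\int[likelihood x1]_s \int[likelihood x2]_t (\1_A (s, t))%:E)%E.
  transitivity (\int[prod_prob (likelihood x1) (likelihood x2)]_z (\1_A z)%:E)%E.
    by rewrite (integral_indic _ measurableT mA) setIT.
  exact: (fubini_tonelli1 (m1 := likelihood x1) (m2 := likelihood x2) _ mI I0).
rewrite lE; last 2 first.
- exact: (measurable_fun_fubini_tonelli_F (m2 := likelihood x2) _ mI I0).
- by move=> s; apply: integral_ge0 => t _; rewrite lee_fin.
rewrite [RHS]integral_mkcond epatch_indic fubini_tonelli1; last 2 first.
- by apply: emeasurable_funM => //; exact/measurable_EFinP.
- by move=> z; rewrite mule_ge0 ?lee_fin.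
apply: eq_integral => s _; rewrite lE; last 2 first.
- exact: (measurableT_comp mI (pair1_measurable s)).
- by move=> t; rewrite lee_fin.
rewrite -ge0_integralZr//; last 3 first.
- apply: emeasurable_funM; last exact/measurable_EFinP.
  exact: (measurableT_comp mI (pair1_measurable s)).
- by move=> t _; rewrite mule_ge0 ?lee_fin// density_ge0.
- by rewrite lee_fin density_ge0.
by apply: eq_integral => t _; rewrite /= -!EFinM /rho; congr EFin => /=; ring.
Qed.

Lemma pullback_is_kernel : is_kernel (pullback_kernel f k).
Proof.
have b : bdm (fun z : X * X => pullback_kernel f k z.1 z.2).
  under eq_fun do rewrite pullback_kernelE.
  (* The sample space is [X * X], with the likelihoods of the two coordinates as random
     probabilities. *)
  apply: bdm_mmd_dot => // A mA.
    exact: (measurableT_comp (measurable_likelihood mA) measurable_fst).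
  exact: (measurableT_comp (measurable_likelihood mA) measurable_snd).
split.
- by case: b.
- by case: b => _ [M bM]; exists M => s t; exact: (bM (s, t)).
- by move=> s t; rewrite !pullback_kernelE mmd_dotC.
- move=> n s a; under eq_bigr do under eq_bigr do rewrite pullback_kernelE.
  exact: mmd_dot_psd.
Qed.

(** Each mixture is a mean of likelihoods; unfold the two arguments one after the other with
    [Rintegral_mean]. *)
Lemma mmd_dot_mixture (P Q : probability X R) :
  mmd_dot k (mixture_prob f P) (mixture_prob f Q) =
  mmd_dot (pullback_kernel f k) P Q.
Proof.
rewrite {1}/mmd_dot (Rintegral_mean measurable_likelihood (likelihood_mean Q));
  last exact: bdm_kme.
apply: eq_Rintegral => x _; rewrite -/(mmd_dot k _ _) mmd_dotC//.
rewrite {1}/mmd_dot (Rintegral_mean measurable_likelihood (likelihood_mean P));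
  last exact: bdm_kme.
by apply: eq_Rintegral => x' _; rewrite pullback_kernelE mmd_dotC.
Qed.

End likelihood_kernel.

(** * Kernel covariances and variances of random mixtures *)

Section mixtures_of_random_probabilities.
Context (R : realType) (d d' d0 : measure_display).
Context (Y : measurableType d) (X : measurableType d') (Omega : measurableType d0).
Context (nu : {sigma_finite_measure set Y -> \bar R}).
Variables (f : density_kernel X nu) (Pr : probability Omega R).
Variables (k : Y -> Y -> R) (kk : is_kernel k).
Variables (Hk : rkhs k) (Hkf : rkhs (pullback_kernel f k)).

Let kfk := pullback_is_kernel f kk.

(** Identifiability speaks of densities almost everywhere; integrable densities with equal integrals
    over all measurable sets agree almost everywhere. *)
Lemma mixture_prob_inj (P Q : probability X R) : identifiable f ->
  same_probability (mixture_prob f P) (mixture_prob f Q) -> same_probability P Q.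
Proof.
move=> f_id fPQ; apply: f_id; apply: integral_ae_eq => //.
- apply/integrableP; split; first exact: measurable_mixture_density.
  under eq_integral do rewrite gee0_abs ?mixture_density_ge0//.
  have := probability_setT (mixture_prob f P).
  by rewrite /mixture_prob /= /mixture => ->; rewrite ltry.
- exact: measurable_mixture_density.
- by move=> A _ mA; exact: fPQ.
Qed.

Lemma kcov_mixture (P1 P2 : Omega -> probability X R) (M1 M2 : probability X R) :
  measurable_prob P1 -> measurable_prob P2 ->
  is_mean Pr P1 M1 -> is_mean Pr P2 M2 ->
  kcov Pr Hk (fun w => mixture_prob f (P1 w)) (fun w => mixture_prob f (P2 w)) =
  kcov Pr Hkf P1 P2.
Proof.
move=> m1 m2 PM1 PM2; rewrite (kcovE kfk Hkf m1 m2 PM1 PM2).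
rewrite (kcovE kk Hk (measurable_mixture_prob f m1) (measurable_mixture_prob f m2)
  (mixture_prob_mean f m1 PM1) (mixture_prob_mean f m2 PM2)).
rewrite mmd_dot_mixture//; congr (_ - _)%:E.
by apply: eq_Rintegral => w _; exact: mmd_dot_mixture.
Qed.

(** Otherwise the embedding of the mixture would be almost surely constant, hence so would the
    mixture, as [k] is characteristic, and then [P], by identifiability. *)
Lemma kvar_mixture_gt0 (P : Omega -> probability X R) (M : probability X R) :
  identifiable f -> characteristic k ->
  measurable_prob P -> is_mean Pr P M -> ~ deterministic_prob Pr P ->
  (0 < kvar Pr Hk (fun w => mixture_prob f (P w)))%E.
Proof.
move=> f_id k_char mP PM ndet.
apply: (kvar_gt0 kk Hk (measurable_mixture_prob f mP) (mixture_prob_mean f mP PM)).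
move=> kme_ae; apply: ndet; exists M; apply: filterS kme_ae => w /k_char.
exact: mixture_prob_inj.
Qed.

End mixtures_of_random_probabilities.

(** * Equality of the three correlations *)

Lemma measurable_prob_RV (R : realType) d d' (Omega : measurableType d)
    (S : measurableType d') (Pr : probability Omega R)
    (P : {RV Pr >-> pprobability S R}) : measurable_prob P.
Proof.
by move=> A mA; exact: (measurable_kernel (kprobability (measurable_funPT P)) A mA).
Qed.

(** Cancels the common factor of covariance and variances, which is [D] for the kernel correlation
    and [P0(A)(1 - P0(A))] for the correlation at [A]; both reduce to
    [eta / (sqrt lambda1 * sqrt lambda2)]. *)
Lemma ratio_sqrt_scale (R : realType) (a c l1 l2 : R) : 0 < a -> 0 < l1 -> 0 < l2 ->
  c * a / (Num.sqrt (l1 * a) * Num.sqrt (l2 * a)) = c / (Num.sqrt l1 * Num.sqrt l2).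
Proof.
move=> a0 l10 l20; rewrite !sqrtrM ?ltW// mulrACA -(expr2 (Num.sqrt a)).
by rewrite sqr_sqrtr ?ltW// -mulf_div divff ?mulr1// gt_eqF.
Qed.

Theorem corollary15 (R : realType) (X Y : ptopologicalType)
    (X_polish : polish R X) (X_lc : locally_compact [set: X])
    (Y_polish : polish R Y) (Y_lc : locally_compact [set: Y])
    (nu : {sigma_finite_measure set (borel Y) -> \bar R})
    (d : measure_display) (Omega : measurableType d) (Pr : probability Omega R)
    (P1 P2 : {RV Pr >-> pprobability (borel X) R})
    (P1_nd : ~ deterministic_prob Pr P1) (P2_nd : ~ deterministic_prob Pr P2)
    (P0 : probability (borel X) R)
    (P1_mean : forall A : set (borel X), measurable A ->
       mean_measure Pr P1 A = P0 A)
    (P2_mean : forall A : set (borel X), measurable A ->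
       mean_measure Pr P2 A = P0 A)
    (eta lambda1 lambda2 : R)
    (eta_bnd : -1 <= eta <= 1)
    (lambda1_bnd : 0 < lambda1 <= 1) (lambda2_bnd : 0 < lambda2 <= 1)
    (P12_cov : forall A : set (borel X), measurable A ->
       (covariance Pr (eval_prob P1 A) (eval_prob P2 A) =
        eta%:E * P0 A * (1 - P0 A))%E)
    (P1_var : forall A : set (borel X), measurable A ->
       ('V_Pr[eval_prob P1 A] = lambda1%:E * P0 A * (1 - P0 A))%E)
    (P2_var : forall A : set (borel X), measurable A ->
       ('V_Pr[eval_prob P2 A] = lambda2%:E * P0 A * (1 - P0 A))%E)
    (f : density_kernel (borel X) nu) (f_id : identifiable f)
    (k : borel Y -> borel Y -> R) (k_kernel : is_kernel k)
    (k_char : characteristic k) :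
  is_kernel (pullback_kernel f k) /\
  forall (Hk : rkhs k) (Hkf : rkhs (pullback_kernel f k)),
    let fP1 w := mixture_prob f (P1 w) in
    let fP2 w := mixture_prob f (P2 w) in
    [/\ (0 < kvar Pr Hk fP1)%E, (0 < kvar Pr Hk fP2)%E,
        (0 < kvar Pr Hkf P1)%E & (0 < kvar Pr Hkf P2)%E] /\
    forall A : set (borel X), measurable A ->
      ~ deterministic_rv Pr (eval_prob P1 A) ->
      ~ deterministic_rv Pr (eval_prob P2 A) ->
      kcorr Pr Hk fP1 fP2 = kcorr Pr Hkf P1 P2 /\
      kcorr Pr Hkf P1 P2 =
        correlation Pr (eval_prob P1 A) (eval_prob P2 A).
Proof.
have kfk := pullback_is_kernel f k_kernel; split=> // Hk Hkf fP1 fP2.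
have m1 : measurable_prob P1 := measurable_prob_RV P1.
have m2 : measurable_prob P2 := measurable_prob_RV P2.
have /andP[l1 l1'] := lambda1_bnd; have /andP[l2 l2'] := lambda2_bnd.
have l1b : -1 <= lambda1 <= 1 by rewrite l1' andbT; lra.
have l2b : -1 <= lambda2 <= 1 by rewrite l2' andbT; lra.
(* Positivity is proved on the observation space, where [k] is characteristic, and carried to the
   latent space by the equalities of variances [E11] and [E22]. *)
have v1 : (0 < kvar Pr Hk fP1)%E.
  exact: (kvar_mixture_gt0 k_kernel Hk f_id k_char m1 P1_mean P1_nd).
have v2 : (0 < kvar Pr Hk fP2)%E.
  exact: (kvar_mixture_gt0 k_kernel Hk f_id k_char m2 P2_mean P2_nd).
have E11 : kvar Pr Hk fP1 = kvar Pr Hkf P1.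
  exact: (kcov_mixture k_kernel Hk Hkf m1 m1 P1_mean P1_mean).
have E22 : kvar Pr Hk fP2 = kvar Pr Hkf P2.
  exact: (kcov_mixture k_kernel Hk Hkf m2 m2 P2_mean P2_mean).
have E12 : kcov Pr Hk fP1 fP2 = kcov Pr Hkf P1 P2.
  exact: (kcov_mixture k_kernel Hk Hkf m1 m2 P1_mean P2_mean).
split; first by split; [exact: v1|exact: v2|move: v1; rewrite E11|move: v2; rewrite E22].
move=> A mA A1_nd A2_nd; split.
  by congr (fine _ / (Num.sqrt (fine _) * Num.sqrt (fine _))); [exact: E12|exact: E11|exact: E22].
pose D := \int[P0]_x pullback_kernel f k x x - mmd_dot (pullback_kernel f k) P0 P0.
(* One formula for the covariance and both variances, with [c] equal to [eta], [lambda1] and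
   [lambda2] in turn. *)
have kcovD (Q1 Q2 : Omega -> probability (borel X) R) c :
    measurable_prob Q1 -> measurable_prob Q2 ->
    is_mean Pr Q1 P0 -> is_mean Pr Q2 P0 -> -1 <= c <= 1 ->
    (forall B, measurable B -> (covariance Pr (eval_prob Q1 B) (eval_prob Q2 B) =
       c%:E * P0 B * (1 - P0 B))%E) ->
    kcov Pr Hkf Q1 Q2 = (c * D)%:E.
  move=> mQ1 mQ2 Q1_mean Q2_mean c1 Qcov.
  rewrite (kcovE kfk Hkf mQ1 mQ2 Q1_mean Q2_mean).
  rewrite (expected_mmd_dot mQ1 mQ2 Q1_mean Q2_mean c1 Qcov kfk).
  by congr EFin; rewrite /D; ring.
have c12 := kcovD _ _ _ m1 m2 P1_mean P2_mean eta_bnd P12_cov.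
have c11 : kvar Pr Hkf P1 = (lambda1 * D)%:E.
  exact: (kcovD _ _ _ m1 m1 P1_mean P1_mean l1b P1_var).
have c22 : kvar Pr Hkf P2 = (lambda2 * D)%:E.
  exact: (kcovD _ _ _ m2 m2 P2_mean P2_mean l2b P2_var).
have D0 : 0 < D by move: v1; rewrite E11 c11 lte_fin pmulr_rgt0.
pose p := fine (P0 A); pose q := p * (1 - p).
have PE c : (c%:E * P0 A * (1 - P0 A))%E = (c * q)%:E.
  by rewrite -(fine_probabilityK P0 mA) -EFinB -!EFinM mulrA.
(* If [q] were zero, the variance of [P1(A)] would vanish and [P1(A)] would be deterministic. *)
have q0 : 0 < q.
  have p0 : 0 <= p by rewrite fine_ge0.
  have p1 : p <= 1 by rewrite -lee_fin fine_probabilityK// probability_le1.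
  rewrite lt_def mulr_ge0 ?subr_ge0// andbT; apply/eqP => q_eq0.
  apply: A1_nd; apply: variance_eq0; first exact: eval_prob_bdm.
  by rewrite P1_var// PE q_eq0 mulr0.
rewrite /kcorr /correlation c12 c11 c22 P12_cov// P1_var// P2_var// !PE /=.
by rewrite !ratio_sqrt_scale.
Qed.
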